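(* Let $G$ be a finite simple graph, let $x\in V(G)$, and let $G'$ be the graph obtained from $G$ by adding a new vertex $x'$ and connecting it to all vertices in $N_G[x]$. If $G$ is Cohen-Macaulay (respectively sequentially Cohen-Macaulay, respectively shellable), then $G'$ is Cohen-Macaulay (respectively sequentially Cohen-Macaulay, respectively shellable).
   Context: $N_G(x)=\{y\in V(G):\{x,y\}\in E(G)\}$ and $N_G[x]=N_G(x)\cup\{x\}$. Fix a field $K$. The independence complex of a graph $H$ is $\Delta_H=\{F\subseteq V(H): e\not\subseteq F\text{ for all } e\in E(H)\}$. A simplicial complex is called Cohen-Macaulay (resp. sequentially Cohen-Macaulay) if its Stanley-Reisner ring over $K$ is Cohen-Macaulay (resp. sequentially Cohen-Macaulay). A graph $H$ is Cohen-Macaulay (resp. sequentially Cohen-Macaulay, shellable) if $\Delta_H$ is Cohen-Macaulay (resp. sequentially Cohen-Macaulay, shellable in the not necessarily pure sense of Björner–Wachs). *)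

(* Defs.v *)
From HB Require Import structures.
From mathcomp Require Import all_boot all_order all_algebra.
From mathcomp Require Import mpoly.

Set Implicit Arguments.
Unset Strict Implicit.
Unset Printing Implicit Defensive.

Import GRing.Theory.
Local Open Scope ring_scope.

(* Ideals of a commutative ring are Prop-valued predicates, and a pair of     *)
(* ideals I \subset J stands for the module J / I.  This is enough to speak   *)
(* of the cyclic module R / I and of the quotients of successive submodules   *)
(* in a filtration of R / I: the submodules of R / I are the J / I.           *)

Definition sub_pred {T : Type} (A B : T -> Prop) : Prop := forall a, A a -> B a.

Definition same_pred {T : Type} (A B : T -> Prop) : Prop :=
  forall a, A a <-> B a.

Definition whole {T : Type} : T -> Prop := fun _ => True.

Definition is_ideal (R : comNzRingType) (I : R -> Prop) : Prop :=
  [/\ I 0, (forall a b, I a -> I b -> I (a + b))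
    & forall r a, I a -> I (r * a)].

Definition is_prime_ideal (R : comNzRingType) (P : R -> Prop) : Prop :=
  [/\ is_ideal P, ~ P 1 & forall a b, P (a * b) -> P a \/ P b].

Definition ideal_gen (R : comNzRingType) (B : R -> Prop) : R -> Prop :=
  fun a => forall I, is_ideal I -> sub_pred B I -> I a.

(* Annihilator of J / I. *)
Definition ann (R : comNzRingType) (J I : R -> Prop) : R -> Prop :=
  fun f => forall g, J g -> I (f * g).

(* The ideal I + f J, so that (J / I) / f (J / I) is J / (I + f J). *)
Definition add_mul (R : comNzRingType) (I : R -> Prop) (f : R)
    (J : R -> Prop) : R -> Prop :=
  fun a => exists b c, [/\ I b, J c & a = b + f * c].

(* f is a nonzerodivisor on J / I. *)
Definition regular_on (R : comNzRingType) (J I : R -> Prop) (f : R) : Prop :=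
  forall g, J g -> I (f * g) -> I g.

(* In the base case, the last quotient M / (f_1, ..., f_r) M is nonzero. *)
Fixpoint regular_seq (R : comNzRingType) (J I : R -> Prop) (fs : seq R) : Prop :=
  match fs with
  | [::] => ~ sub_pred J I
  | f :: fs' => regular_on J I f /\ regular_seq J (add_mul I f J) fs'
  end.

(* There is a strict chain P_0 < ... < P_d of primes of R / ann (J / I). *)
Definition has_prime_chain (R : comNzRingType) (J I : R -> Prop) (d : nat) : Prop :=
  exists P : nat -> R -> Prop,
    (forall i, (i <= d)%N -> is_prime_ideal (P i) /\ sub_pred (ann J I) (P i)) /\
    (forall i, (i < d)%N -> sub_pred (P i) (P i.+1) /\ ~ sub_pred (P i.+1) (P i)).

Definition krull_dim (R : comNzRingType) (J I : R -> Prop) (d : nat) : Prop :=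
  has_prime_chain J I d /\ forall e, has_prime_chain J I e -> (e <= d)%N.

Definition graded_ideal (K : fieldType) (n : nat) (I : {mpoly K[n]} -> Prop) : Prop :=
  is_ideal I /\ forall p, I p -> forall d, I (pihomog mdeg d p).

Definition homog_pos (K : fieldType) (n : nat) (f : {mpoly K[n]}) : Prop :=
  exists2 d, (0 < d)%N & f \is d.-homog.

(* Depth of a graded module: the largest length of a homogeneous regular      *)
(* sequence in the irrelevant maximal ideal.                                  *)
Definition has_graded_regular_seq (K : fieldType) (n : nat)
    (J I : {mpoly K[n]} -> Prop) (d : nat) : Prop :=
  exists fs : seq {mpoly K[n]},
    [/\ size fs = d, (forall f, f \in fs -> homog_pos f) & regular_seq J I fs].

Definition gdepth (K : fieldType) (n : nat) (J I : {mpoly K[n]} -> Prop)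
    (d : nat) : Prop :=
  has_graded_regular_seq J I d /\
  forall e, has_graded_regular_seq J I e -> (e <= d)%N.

(* The zero module has no Krull dimension here, hence J / I is nonzero. *)
Definition CM_module (K : fieldType) (n : nat)
    (J I : {mpoly K[n]} -> Prop) : Prop :=
  exists2 d, krull_dim J I d & gdepth J I d.

(* The submodules of J / I in the filtration 0 = M_0 < M_1 < ... < M_r = J / I *)
(* are the M i / I.                                                            *)
Definition seqCM_module (K : fieldType) (n : nat)
    (J I : {mpoly K[n]} -> Prop) : Prop :=
  exists (r : nat) (M : nat -> {mpoly K[n]} -> Prop) (d : nat -> nat),
    [/\ same_pred (M 0%N) I /\ same_pred (M r) J,
        (forall i, (i <= r)%N -> graded_ideal (M i)),
        (forall i, (i < r)%N ->
           [/\ sub_pred (M i) (M i.+1), CM_module (M i.+1) (M i)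
             & krull_dim (M i.+1) (M i) (d i)])
      & forall i, (i.+1 < r)%N -> (d i < d i.+1)%N].

(* The variables of the polynomial ring are indexed by V through enum_rank. *)
Definition face_monomial (K : fieldType) (V : finType) (F : {set V})
    : {mpoly K[#|V|]} :=
  \prod_(v in F) 'X_(enum_rank v).

Definition SR_ideal (K : fieldType) (V : finType) (D : {set {set V}})
    : {mpoly K[#|V|]} -> Prop :=
  ideal_gen (fun p => exists2 F : {set V}, F \notin D & p = face_monomial K F).

Definition CM_complex (K : fieldType) (V : finType) (D : {set {set V}}) : Prop :=
  CM_module whole (@SR_ideal K V D).

Definition seqCM_complex (K : fieldType) (V : finType) (D : {set {set V}}) : Prop :=
  seqCM_module whole (@SR_ideal K V D).

Definition facets (V : finType) (D : {set {set V}}) : {set {set V}} :=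
  [set F | maxset (fun A : {set V} => A \in D) F].

(* The complex (<F_1> \cup ... \cup <F_(j-1)>) \cap <F_j>, s = F_1..F_(j-1). *)
Definition shelling_meet (V : finType) (s : seq {set V}) (F : {set V})
    : {set {set V}} :=
  [set E : {set V} | (E \subset F) && has (fun F' : {set V} => E \subset F') s].

(* Nonpure shellability: the complex above is pure of dimension dim F_j - 1   *)
(* for j >= 2.  It contains the empty face, so it has at least one facet.     *)
Definition shellable_complex (V : finType) (D : {set {set V}}) : Prop :=
  exists s : seq {set V},
    [/\ uniq s, s =i facets D
      & forall j, (0 < j < size s)%N ->
          forall E, E \in facets (shelling_meet (take j s) (nth set0 s j)) ->
            #|E|.+1 = #|nth set0 s j|].

Record sgraph (V : finType) := SGraph {
  adj : rel V;
  adj_sym : ssrbool.symmetric adj;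
  adj_irrefl : irreflexive adj
}.

Definition nbhd (V : finType) (G : sgraph V) (x : V) : {set V} :=
  [set y | adj G x y].

Definition closed_nbhd (V : finType) (G : sgraph V) (x : V) : {set V} :=
  x |: nbhd G x.

Definition edges (V : finType) (G : sgraph V) : {set {set V}} :=
  [set e : {set V} | [exists u, exists v, adj G u v && (e == [set u; v])]].

Definition indep_complex (V : finType) (G : sgraph V) : {set {set V}} :=
  [set F : {set V} | [forall e in edges G, ~~ (e \subset F)]].

(* The new vertex x' is None; the old vertices are the Some v. *)
Definition twin_adj (V : finType) (G : sgraph V) (x : V) : rel (option V) :=
  fun a b => match a, b with
  | Some u, Some v => adj G u v
  | Some u, None => u \in closed_nbhd G x
  | None, Some v => v \in closed_nbhd G x
  | None, None => false
  end.

Lemma twin_adj_sym (V : finType) (G : sgraph V) (x : V) :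
  ssrbool.symmetric (twin_adj G x).
Proof. by move=> [u|] [v|] //=; apply: adj_sym. Qed.

Lemma twin_adj_irrefl (V : finType) (G : sgraph V) (x : V) :
  irreflexive (twin_adj G x).
Proof. by move=> [u|] //=; apply: adj_irrefl. Qed.

Definition add_twin (V : finType) (G : sgraph V) (x : V) : sgraph (option V) :=
  SGraph (@twin_adj_sym V G x) (@twin_adj_irrefl V G x).

Definition CM_graph (K : fieldType) (V : finType) (G : sgraph V) : Prop :=
  CM_complex K (indep_complex G).

Definition seqCM_graph (K : fieldType) (V : finType) (G : sgraph V) : Prop :=
  seqCM_complex K (indep_complex G).

Definition shellable_graph (V : finType) (G : sgraph V) : Prop :=
  shellable_complex (indep_complex G).

(* Main.v *)
(* Write R for the Stanley-Reisner ring of G. That of G' is the fibre product *)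
(* of two copies of R over R/(x), so over the diagonal x |-> x + x' it is the *)
(* direct sum R + xR, and the point is that xR is as deep as R. Squaring all  *)
(* variables makes R a module over the polynomial ring that contains a copy   *)
(* of both R and xR as a direct summand, because the ideal is squarefree.     *)
(* Hence a sequence g whose image under x_v |-> x_v^2 is R-regular is itself  *)
(* regular on both. For R Cohen-Macaulay of dimension d, take for g the       *)
(* elementary symmetric polynomials e_1, ..., e_d: those of higher degree     *)
(* vanish on R, so the x_v are nilpotent modulo the image of g, and the       *)
(* Koszul complex transfers regularity to this image from any regular         *)
(* sequence of length d. The same argument applies to J/I for squarefree      *)
(* monomial ideals I, J, and the terms of the filtration of a sequentially    *)
(* Cohen-Macaulay R are of this form. For shellability, append to a shelling  *)
(* of G the twins of its facets through x, in the same order.                 *)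

(* The transfer of regularity is the depth sensitivity of Koszul cohomology. Let M = J/I. If [fs] is
   regular on M and its elements are nilpotent modulo (gs) + ann M, then H^i(gs; M) = 0 for i <
   [size fs] ([kos_vanish_regular]); for homogeneous [gs] of the same length this makes [gs] regular
   ([kos_vanish_wreg]). [CM_frob_elem_sym_regular] applies this to the e_k in the squared variables,
   [twin_weak_regular] moves the result to G' along direct summand maps, and [twin_prime_chain]
   bounds the dimension there. As depth never exceeds dimension ([regular_seq_prime_chain]), this
   yields [CM_twin_lift]. By [dimension_filtration] it applies to each quotient of a sequentially
   Cohen-Macaulay filtration and keeps its dimension. In [shellable_add_twin] the point is that a
   facet through x and its twin differ in one vertex. *)
Require Import Defs.
From HB Require Import structures.
From mathcomp Require Import all_boot all_order all_algebra.
From mathcomp Require Import mpoly ring zify.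
From mathcomp Require boolp classical_sets.
From Stdlib Require Import Classical.

Set Implicit Arguments.
Unset Strict Implicit.
Unset Printing Implicit Defensive.

Import GRing.Theory.
Local Open Scope ring_scope.

(** * Ideals and weakly regular sequences *)

Section Ideals.
Variable R : comNzRingType.
Implicit Types (I J : R -> Prop) (a b f g : R) (fs gs : seq R).

Lemma idealN I a : is_ideal I -> I a -> I (- a).
Proof. by case=> _ _ IM Ia; rewrite -mulN1r; apply: IM. Qed.

Lemma idealB I a b : is_ideal I -> I a -> I b -> I (a - b).
Proof. by move=> idI Ia Ib; case: (idI) => _ ID _; apply: ID => //; apply: idealN. Qed.

Lemma ideal_sum I (T : Type) (r : seq T) (P : pred T) (F : T -> R) :
  is_ideal I -> (forall i, P i -> I (F i)) -> I (\sum_(i <- r | P i) F i).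
Proof.
by case=> I0 ID _ IF; apply: (big_ind I).
Qed.

Lemma is_ideal_add_mul I J f :
  is_ideal I -> is_ideal J -> is_ideal (add_mul I f J).
Proof.
move=> [I0 ID IM] [J0 JD JM]; split.
- by exists 0, 0; rewrite mulr0 addr0.
- move=> _ _ [b [c [Ib Jc ->]]] [b' [c' [Ib' Jc' ->]]].
  by exists (b + b'), (c + c'); split; [exact: ID | exact: JD | ring].
- move=> r _ [b [c [Ib Jc ->]]].
  by exists (r * b), (r * c); split; [exact: IM | exact: JM | ring].
Qed.

Lemma add_mul_l I J f a : is_ideal J -> I a -> add_mul I f J a.
Proof. by move=> [J0 _ _] Ia; exists a, 0; rewrite mulr0 addr0. Qed.

Lemma add_mul_r I J f a : is_ideal I -> J a -> add_mul I f J (f * a).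
Proof. by move=> [I0 _ _] Ja; exists 0, a; rewrite add0r. Qed.

Lemma add_mul_sub I J f :
  is_ideal J -> sub_pred I J -> sub_pred (add_mul I f J) J.
Proof.
by move=> [_ JD JM] IJ _ [b [c [Ib Jc ->]]]; apply: JD; [exact: IJ | exact: JM].
Qed.

Lemma is_ideal_colon I a : is_ideal I -> is_ideal (fun s => I (s * a)).
Proof.
move=> [I0 ID IM]; split; first by rewrite mul0r.
- by move=> s t; rewrite mulrDl; apply: ID.
- by move=> r s; rewrite -mulrA; apply: IM.
Qed.

Lemma is_ideal_ann I J : is_ideal I -> is_ideal (ann J I).
Proof.
move=> [I0 ID IM]; split; first by move=> g _; rewrite mul0r.
- by move=> s t As At g Jg; rewrite mulrDl; apply: ID; [exact: As | exact: At].
- by move=> r s As g Jg; rewrite -mulrA; apply/IM/As.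
Qed.

(** An ideal maximal among those that contain [I] and miss the multiplicative set [W] is prime. *)
Lemma prime_avoiding I (W : R -> Prop) :
  is_ideal I -> W 1 -> (forall a b, W a -> W b -> W (a * b)) ->
  (forall a, I a -> ~ W a) ->
  exists Q, [/\ is_prime_ideal Q, sub_pred I Q & forall a, Q a -> ~ W a].
Proof.
move=> idI W1 WM IW.
(* Zorn's lemma includes the empty chain, whose union is empty; joining [I] makes it an ideal. *)
pose U (B : R -> Prop) a := I a \/ B a.
pose P B := is_ideal (U B) /\ forall a, B a -> ~ W a.
have [|B [[idB BW] Bmax]] := @classical_sets.Zorn_bigcup R P.
  move=> F FP Ftot; split; last by move=> a [B FB Ba]; apply: (FP B FB).2.
  case: (idI) => I0 ID IM; split; first by left.
  - have sub B : F B -> sub_pred (U B) (U (classical_sets.bigcup F id)).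
      by move=> FB c [?|?]; [left | right; exists B].
    move=> a b [Ia|[B FB Ba]] [Ib|[B' FB' Bb]]; first by left; apply: ID.
    + case: ((FP _ FB').1) => _ D _; apply: (sub _ FB').
      by apply: D; [left | right].
    + case: ((FP _ FB).1) => _ D _; apply: (sub _ FB).
      by apply: D; [right | left].
    + case: (Ftot _ _ FB FB') => BB'.
      * case: ((FP _ FB').1) => _ D _; apply: (sub _ FB').
        by apply: D; right => //; apply: BB'.
      * case: ((FP _ FB).1) => _ D _; apply: (sub _ FB).
        by apply: D; right => //; apply: BB'.
  - move=> r a [Ia|[B FB Ba]]; first by left; apply: IM.
    case: ((FP _ FB).1) => _ _ M.
    by case: (M r a (or_intror Ba)) => ?; [left | right; exists B].
have UW a : U B a -> ~ W a by case; [exact: IW | exact: BW].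
(* By maximality, adjoining an element outside [U B] gives an ideal that meets [W]. *)
have meet x : ~ U B x -> exists2 w, W w & exists q r, U B q /\ w = q + r * x.
  move=> Ux; apply: NNPP => nW; pose C a := exists q r, U B q /\ a = q + r * x.
  case: (idB) => B0 BD BM.
  have BC a : U B a -> C a by move=> Ba; exists a, 0; rewrite mul0r addr0.
  apply: (Bmax C).
    split; last first.
      move=> CB; apply: Ux; right; apply: CB.
      by exists 0, 1; rewrite mul1r add0r.
    by move=> a Ba; apply: BC; right.
  split; last by move=> a Ca Wa; apply: nW; exists a.
  have UC a : U C a <-> C a.
    by split=> [[Ia|//]|]; [apply: BC; left | right].
  split; first by apply/UC/BC.
  - move=> a b /UC[q [r [Bq ->]]] /UC[q' [r' [Bq' ->]]]; apply/UC.
    by exists (q + q'), (r + r'); split; [exact: BD | ring].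
  - move=> s a /UC[q [r [Bq ->]]]; apply/UC.
    by exists (s * q), (s * r); split; [exact: BM | ring].
exists (U B); split=> //; last by move=> a; left.
split=> //; first by move/UW; apply.
move=> a b Bab; apply: NNPP => nab.
have [/meet[w Ww [q [r [Bq ew]]]] /meet[w' Ww' [q' [r' [Bq' ew']]]]] :
  ~ U B a /\ ~ U B b by split=> ?; apply: nab; [left | right].
case: (idB) => B0 BD BM.
apply: (UW (w * w')); last exact: WM.
have ->: w * w' = q' * w + (r' * b) * q + (r * r') * (a * b).
  by rewrite ew ew'; ring.
apply: (BD _ _); last exact: BM.
by apply: (BD _ _); [rewrite mulrC; apply: BM | apply: BM].
Qed.

(** [has_prime_chain J I] is the case of [ann J I]; other ideals needed are the colon ideals (I : u)
    and the face primes. *)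
Definition prime_chain_above I d : Prop :=
  exists P : nat -> R -> Prop,
    (forall i, (i <= d)%N -> is_prime_ideal (P i) /\ sub_pred I (P i)) /\
    (forall i, (i < d)%N -> sub_pred (P i) (P i.+1) /\ ~ sub_pred (P i.+1) (P i)).

Lemma prime_chain_above_sub I J d :
  sub_pred I J -> prime_chain_above J d -> prime_chain_above I d.
Proof.
move=> IJ [P [P1 P2]]; exists P; split=> // i id.
by split; [exact: (P1 i id).1 | move=> a Ia; apply: (P1 i id).2; apply: IJ].
Qed.

(** Without the final nonvanishing, the notion passes to direct summands, which may be zero;
    [weak_regular_seq_regular] restores it for nonzero graded modules. *)
Fixpoint weak_regular_seq J I fs : Prop :=
  match fs with
  | [::] => True
  | f :: fs' => regular_on J I f /\ weak_regular_seq J (add_mul I f J) fs'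
  end.

Lemma regular_seq_weak J I fs : regular_seq J I fs -> weak_regular_seq J I fs.
Proof. by elim: fs I => //= f fs IH I [? /IH]. Qed.

Lemma regular_seq_nonzero J I fs :
  is_ideal J -> regular_seq J I fs -> ~ sub_pred J I.
Proof.
move=> idJ; elim: fs I => //= f fs IH I [_ /IH nz] JI.
by apply: nz => a Ja; apply: add_mul_l => //; apply: JI.
Qed.

(* Iterated [add_mul], the head of the list being the last element added. *)
Fixpoint quot_seq J I gs : R -> Prop :=
  if gs is g :: gs' then add_mul (quot_seq J I gs') g J else I.

Lemma weak_regular_seq_rcons J I gs g :
  weak_regular_seq J I (rcons gs g) <->
  weak_regular_seq J I gs /\ regular_on J (quot_seq J I (rev gs)) g.
Proof.
elim: gs I => [|f gs IH] I /=; first by split=> [[]|[]].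
rewrite IH rev_cons.
suff -> : quot_seq J I (rcons (rev gs) f) = quot_seq J (add_mul I f J) (rev gs).
  by split=> [[? []]|[[]]].
by elim: (rev gs) => //= h l ->.
Qed.

End Ideals.

(* A weakly regular sequence descends to direct summands, and extends to      *)
(* direct sums, of modules over a base ring [T].                              *)
Lemma weak_regular_seq_transfer (T A B : comNzRingType)
    (phi : {rmorphism T -> A}) (psi : {rmorphism T -> B})
    (J I : A -> Prop) (J0 I0 : B -> Prop)
    (al1 al2 : A -> B) (be1 be2 : B -> A) (gs : seq T) :
  {morph al1 : a b / a + b} -> {morph al2 : a b / a + b} ->
  {morph be1 : a b / a + b} -> {morph be2 : a b / a + b} ->
  is_ideal I -> is_ideal J ->
  (forall t a, al1 (phi t * a) = psi t * al1 a) ->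
  (forall t a, al2 (phi t * a) = psi t * al2 a) ->
  (forall t b, be1 (psi t * b) = phi t * be1 b) ->
  (forall t b, be2 (psi t * b) = phi t * be2 b) ->
  (forall a, J a -> J0 (al1 a)) -> (forall a, J a -> J0 (al2 a)) ->
  (forall b, J0 b -> J (be1 b)) -> (forall b, J0 b -> J (be2 b)) ->
  (forall a, I a -> I0 (al1 a)) -> (forall a, I a -> I0 (al2 a)) ->
  (forall b, I0 b -> I (be1 b)) -> (forall b, I0 b -> I (be2 b)) ->
  (forall a, J a -> I (a - (be1 (al1 a) + be2 (al2 a)))) ->
  weak_regular_seq J0 I0 (map psi gs) -> weak_regular_seq J I (map phi gs).
Proof.
move=> a1D a2D b1D b2D idI idJ a1 a2 b1 b2 aJ1 aJ2 bJ1 bJ2.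
elim: gs I I0 idI => //= g gs IH I I0 idI aI1 aI2 bI1 bI2 split1 [reg wreg].
split.
  move=> a Ja Iga; rewrite -[a](subrK (be1 (al1 a) + be2 (al2 a))).
  case: (idI) => _ ID _; apply: (ID); first exact: split1.
  apply: (ID); [apply: bI1 | apply: bI2]; apply: reg; try by [apply: aJ1|apply: aJ2].
    by rewrite -a1; apply: aI1.
  by rewrite -a2; apply: aI2.
apply: IH wreg; first exact: is_ideal_add_mul.
- move=> _ [b [c [Ib Jc ->]]]; exists (al1 b), (al1 c).
  by split; [exact: aI1 | exact: aJ1 | rewrite a1D a1].
- move=> _ [b [c [Ib Jc ->]]]; exists (al2 b), (al2 c).
  by split; [exact: aI2 | exact: aJ2 | rewrite a2D a2].
- move=> _ [b [c [Ib Jc ->]]]; exists (be1 b), (be1 c).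
  by split; [exact: bI1 | exact: bJ1 | rewrite b1D b1].
- move=> _ [b [c [Ib Jc ->]]]; exists (be2 b), (be2 c).
  by split; [exact: bI2 | exact: bJ2 | rewrite b2D b2].
- by move=> a Ja; apply: add_mul_l => //; apply: split1.
Qed.

(** * Koszul complexes *)

Section Koszul.
Variable R : comNzRingType.
Implicit Types (I J P : R -> Prop) (f g : R) (fs gs : seq R).

(* The Koszul complex on [k] elements: [kos k.+1] is the mapping cone of      *)
(* multiplication on [kos k].                                                 *)
Fixpoint kos (k : nat) : lmodType R :=
  if k is k'.+1 then (kos k' * kos k')%type : lmodType R else R^o.

Fixpoint kosd gs : kos (size gs) -> kos (size gs) :=
  match gs with
  | [::] => fun=> 0
  | g :: gs' => fun z => (kosd z.1, g *: z.1 - kosd z.2)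
  end.

(* Cochains with values in [P] of cohomological degree [j.-1]: the shift by   *)
(* one makes [j = 0] the zero group in degree [-1].                           *)
Fixpoint koch P (k j : nat) : kos k -> Prop :=
  match k return kos k -> Prop with
  | 0 => fun z => if j == 1%N then P z else z = 0
  | k'.+1 => fun z => koch P j z.1 /\ koch P j.-1 z.2
  end.

Lemma koch0 P k (z : kos k) : koch P 0 z <-> z = 0.
Proof.
elim: k z => //= k IH [a b] /=; rewrite !IH.
by split=> [[-> ->]|[-> ->]].
Qed.

Lemma koch_zero P k j : P 0 -> koch P j (0 : kos k).
Proof. by move=> P0; elim: k j => [|k IH] j /=; [case: eqP | split]. Qed.

Lemma kochD P k j (y z : kos k) :
  is_ideal P -> koch P j y -> koch P j z -> koch P j (y + z).
Proof.
move=> [P0 PD PM]; elim: k j y z => [|k IH] j /= y z.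
  by case: eqP => _; [exact: PD | move=> -> ->; rewrite addr0].
by move=> [? ?] [? ?]; split; apply: IH.
Qed.

Lemma kochZ P k j r (z : kos k) : is_ideal P -> koch P j z -> koch P j (r *: z).
Proof.
move=> [P0 PD PM]; elim: k j z => [|k IH] j /= z.
  by case: eqP => _; [exact: PM | move=> ->; rewrite scaler0].
by move=> [? ?]; split; apply: IH.
Qed.

Lemma kochN P k j (z : kos k) : is_ideal P -> koch P j z -> koch P j (- z).
Proof. by move=> idP Pz; rewrite -scaleN1r; apply: kochZ. Qed.

Lemma kochB P k j (y z : kos k) :
  is_ideal P -> koch P j y -> koch P j z -> koch P j (y - z).
Proof. by move=> idP Py Pz; apply: kochD => //; apply: kochN. Qed.

Lemma koch_sub P P' k j (z : kos k) :
  sub_pred P P' -> koch P j z -> koch P' j z.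
Proof.
move=> PP'; elim: k j z => [|k IH] j z /=; first by case: eqP => // _; apply: PP'.
by case=> ? ?; split; apply: IH.
Qed.

Lemma koch_gt P k j (z : kos k) : (k.+1 < j)%N -> koch P j z -> z = 0.
Proof.
elim: k j z => [|k IH] j z /=; first by move=> j1; case: eqP j1 => [->|_ _ ->].
by case: z => a b /= kj [/(IH _ _ (ltnW kj)) -> /IH -> //]; lia.
Qed.

Lemma koch_add_mul I J f k j (z : kos k) :
  is_ideal I -> is_ideal J -> koch (add_mul I f J) j z ->
  exists b c, [/\ koch I j b, koch J j c & z = b + f *: c].
Proof.
move=> idI idJ; elim: k j z => [|k IH] j z /=.
  case: eqP => [_ [b [c [Ib Jc ->]]]|nj ->]; first by exists b, c.
  by exists 0, 0; rewrite scaler0 addr0.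
case: z => z1 z2 /= [/IH[b1 [c1 [Ib1 Jc1 ->]]] /IH[b2 [c2 [Ib2 Jc2 ->]]]].
by exists (b1, b2), (c1, c2).
Qed.

Lemma koch_scale_add_mul I J f k j (z : kos k) :
  is_ideal I -> koch J j z -> koch (add_mul I f J) j (f *: z).
Proof.
move=> idI; elim: k j z => [|k IH] j z /=.
  by case: eqP => [_|_ ->]; [apply: add_mul_r | rewrite scaler0].
by case=> ? ?; split; apply: IH.
Qed.

Lemma koch_regular I J f k j (z : kos k) :
  is_ideal I -> regular_on J I f -> koch J j z -> koch I j (f *: z) -> koch I j z.
Proof.
move=> idI reg; elim: k j z => [|k IH] j z /=.
  by case: eqP => [_|//]; apply: reg.
by move=> [J1 J2] [I1 I2]; split; apply: IH.
Qed.

Lemma koch_ann I J f k j (z : kos k) :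
  ann J I f -> koch J j z -> koch I j (f *: z).
Proof.
move=> af; elim: k j z => [|k IH] j z /=.
  by case: eqP => [_|_ ->]; [apply: af | rewrite scaler0].
by move=> [J1 J2]; split; apply: IH.
Qed.

Lemma kosdD gs : {morph @kosd gs : y z / y + z}.
Proof.
elim: gs => [|g gs IH] y z /=; first by rewrite addr0.
rewrite !IH scalerDr opprD addrACA; reflexivity.
Qed.

Lemma kosdZ gs r : {morph @kosd gs : z / r *: z}.
Proof.
elim: gs => [|g gs IH] z /=; first by rewrite scaler0.
rewrite !IH scalerA mulrC -scalerA -scalerBr; reflexivity.
Qed.

Lemma kosdN gs : {morph @kosd gs : z / - z}.
Proof. by move=> z; rewrite -scaleN1r kosdZ scaleN1r. Qed.

Lemma kosdB gs : {morph @kosd gs : y z / y - z}.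
Proof. by move=> y z; rewrite kosdD kosdN. Qed.

Lemma kosd0 gs : kosd (0 : kos (size gs)) = 0.
Proof. by rewrite -[X in kosd X](scale0r 0) kosdZ scale0r. Qed.

Lemma kosdd gs (z : kos (size gs)) : kosd (kosd z) = 0.
Proof.
elim: gs z => //= g gs IH z.
by rewrite !IH kosdB kosdZ IH subr0 subrr.
Qed.

Lemma kosd_koch P gs j (z : kos (size gs)) :
  is_ideal P -> koch P j z -> koch P j.+1 (kosd z).
Proof.
move=> idP; have P0 : P 0 by case: idP.
elim: gs j z => [|g gs IH] j z; first by move=> _; apply: koch_zero.
case: z => a b [/= Pa Pb]; split; first exact: IH.
apply: kochB => //; first exact: kochZ.
case: j Pa Pb => [|j] Pa Pb; last exact: IH.
by move/koch0: Pb => ->; rewrite kosd0; apply: koch_zero.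
Qed.

Inductive in_span : seq R -> R -> Prop :=
  | in_span_nil : in_span [::] 0
  | in_span_cons g gs c f : in_span gs f -> in_span (g :: gs) (c * g + f).

(** Contraction with the coefficients of f = sum of c_i g_i is a homotopy from multiplication by f
    to zero. It respects values in any ideal, so (gs) annihilates Koszul cohomology with
    coefficients in J/I. *)
Lemma kos_homotopy gs f : in_span gs f ->
  exists h : kos (size gs) -> kos (size gs),
    [/\ {morph h : y z / y + z}, (forall r, {morph h : z / r *: z}),
        (forall P j z, is_ideal P -> koch P j z -> koch P j.-1 (h z))
      & forall z, kosd (h z) + h (kosd z) = f *: z].
Proof.
elim=> {gs f} [|g gs c f _ [h [hD hZ hP hd]]].
  exists (fun=> 0); split => //=.
  - by move=> y z; rewrite addr0.
  - by move=> r z; rewrite scaler0.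
  - by move=> P j z [P0 _ _] _; case: eqP.
  - by move=> z; rewrite addr0 scale0r.
have hN z : h (- z) = - h z by rewrite -scaleN1r hZ scaleN1r.
exists (fun z => (c *: z.2 + h z.1, - h z.2)); split.
- move=> y z /=; rewrite !hD scalerDr opprD addrACA; reflexivity.
- move=> r z /=; rewrite !hZ -scalerN scalerA (mulrC c) -scalerA -scalerDr.
  reflexivity.
- move=> P j [a b] idP [/= Pa Pb]; split => /=.
    by apply: kochD; [| apply: kochZ | apply: hP].
  by apply: kochN => //; apply: hP.
- case=> a b /=; congr (_, _) => /=.
    rewrite kosdD kosdZ scalerDl -hd scalerBr scalerA.
    by rewrite addrACA [_ + (_ - _)]addrC subrK.
  rewrite kosdN opprK !(hD, hZ, hN) scalerDl -hd scalerDr scalerA (mulrC g).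
  rewrite opprD opprK -!addrA; congr (_ + _).
  by rewrite (addrCA (kosd _)) addrA subrr add0r.
Qed.

(** For M = J/I this is H^i(gs; M) = 0 for i < k: by the shift, index [j] stands for degree j -
    1. *)
Definition kos_vanish J I gs k : Prop :=
  forall j (z : kos (size gs)), (j <= k)%N -> koch J j z -> koch I j.+1 (kosd z) ->
  exists2 w, koch J j.-1 w & koch I j (z - kosd w).

(** Vanishing for M/fM makes f injective on H^i(gs; M) one degree further, while f^N acts there as
    zero, being null-homotopic up to an annihilator of M. *)
Lemma kos_vanish_regular J I fs gs :
  is_ideal I -> is_ideal J -> sub_pred I J -> weak_regular_seq J I fs ->
  (forall f, f \in fs -> exists N f' r, [/\ in_span gs f', ann J I r
                                        & f ^+ N = f' + r]) ->
  kos_vanish J I gs (size fs).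
Proof.
move=> + idJ; elim: fs I => [|f fs IH] I idI IJ /=.
  move=> _ _ j z; rewrite leqn0 => /eqP -> /koch0 -> _; exists 0.
    exact/koch0.
  by rewrite kosd0 subr0; apply/koch0.
move=> [reg wreg] span j z jk Jz Idz.
case: j => [|j] in jk Jz Idz *.
  exists 0; first exact/koch0.
  by rewrite kosd0 subr0; move/koch0: Jz => ->; apply/koch0.
have idfI := is_ideal_add_mul f idI idJ.
have IfI : sub_pred I (add_mul I f J) by move=> a; apply: add_mul_l.
have van : kos_vanish J (add_mul I f J) gs (size fs).
  apply: IH => //; first exact: add_mul_sub.
  move=> f1 f1fs; have [|N [f' [r [sf' ar e]]]] := span f1.
    by rewrite inE f1fs orbT.
  by exists N, f', r; split=> // g Jg; apply/IfI/ar.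
(* Modulo [I]: if f y = dw, then w is a cocycle modulo f, so w = du + f c by induction, and y = dc
   since f is regular. *)
have inj (y : kos (size gs)) : koch J j.+1 y ->
    (exists2 w, koch J j w & koch I j.+1 (f *: y - kosd w)) ->
    exists2 w, koch J j w & koch I j.+1 (y - kosd w).
  move=> Jy [w Jw Iw]; have [||u Ju] := van j w _ Jw; first by [].
    have -> : kosd w = f *: y - (f *: y - kosd w) by rewrite opprB addrC subrK.
    apply: kochB => //; last exact: koch_sub Iw.
    exact: koch_scale_add_mul.
  case/(koch_add_mul idI idJ) => b [c [Ib Jc e]]; exists c => //.
  apply: (koch_regular idI reg).
    by apply: kochB => //; apply: kosd_koch.
  have -> : f *: (y - kosd c) = (f *: y - kosd w) + kosd b.
    have := congr1 (@kosd gs) e; rewrite kosdB kosdd subr0 kosdD kosdZ => ->.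
    by rewrite scalerBr opprD addrA addrAC subrK.
  by apply: kochD => //; apply: kosd_koch.
have [N [f' [r [/kos_homotopy[h [hD hZ hP hd]] ar e]]]] := span f (mem_head _ _).
have {e}: exists2 w, koch J j w & koch I j.+1 (f ^+ N *: z - kosd w).
  exists (h z); first exact: hP Jz.
  rewrite e scalerDl -hd -[kosd _ + _ + _]addrA [kosd _ + _]addrC addrK.
  by apply: kochD; [|exact: (hP I j.+2) | exact: (koch_ann ar)].
elim: N => [|N IHN]; first by rewrite scale1r.
by rewrite exprS -scalerA => /inj/IHN; apply; apply: kochZ.
Qed.
End Koszul.

(** * Graded ideals *)

Section Truncation.
Variables (K : fieldType) (n : nat).
Implicit Types (p q g : {mpoly K[n]}) (I J : {mpoly K[n]} -> Prop).

(** The bound is strict so that [trunc 0] vanishes, in agreement with the truncated subtraction E -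
    d in [truncM]. *)
Definition trunc E p : {mpoly K[n]} := \sum_(d < E) pihomog mdeg d p.

Lemma truncB E : {morph trunc E : p q / p - q}.
Proof. by move=> p q; rewrite /trunc -sumrB; apply: eq_bigr => d _; rewrite raddfB. Qed.

HB.instance Definition _ E :=
  GRing.isZmodMorphism.Build {mpoly K[n]} {mpoly K[n]} (trunc E) (truncB E).

Lemma trunc0 p : trunc 0 p = 0.
Proof. by rewrite /trunc big_ord0. Qed.

Lemma trunc_ge E p : (msize p <= E)%N -> trunc E p = p.
Proof.
move=> pE; rewrite [RHS](pihomog_partitionE (mf := mdeg) (k := E)) //.
Qed.

Lemma trunc_homog E d p :
  p \is d.-homog -> trunc E p = if (d < E)%N then p else 0.
Proof.
move=> hp; rewrite /trunc; case: ltnP => [dE|Ed].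
  rewrite (bigD1 (Ordinal dE)) //= pihomog_dE // big1 ?addr0 // => i.
  by rewrite -val_eqE /= eq_sym => ne; apply: (pihomog_ne0 ne).
apply: big1 => i _; apply: (@pihomog_ne0 _ _ _ d) => //.
by have := ltn_ord i; lia.
Qed.

Lemma truncM E d g p :
  g \is d.-homog -> trunc E (g * p) = g * trunc (E - d) p.
Proof.
move=> hg; rewrite [p]mpolyE mulr_sumr !raddf_sum /= mulr_sumr.
apply: eq_bigr => m _.
have hX : (p@_m *: 'X_[m] : {mpoly K[n]}) \is (mdeg m).-homog.
  by rewrite rpredZ // dhomogX.
rewrite (trunc_homog _ (dhomogM hg hX)) (trunc_homog _ hX) ltn_subRL.
by case: ifP => // _; rewrite mulr0.
Qed.

Lemma trunc_graded E I p : graded_ideal I -> I p -> I (trunc E p).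
Proof. by move=> [idI gI] Ip; apply: ideal_sum => // d _; apply: gI. Qed.

Lemma graded_add_mul I J f d :
  graded_ideal I -> graded_ideal J -> f \is d.-homog ->
  graded_ideal (add_mul I f J).
Proof.
move=> [idI gI] [idJ gJ] hf; split; first exact: is_ideal_add_mul.
have pihE p e : pihomog mdeg e p = trunc e.+1 p - trunc e p.
  by rewrite /trunc big_ord_recr /= addrC addrK.
move=> _ [b [c [Ib Jc ->]]] e; exists (pihomog mdeg e b).
exists (if (d <= e)%N then pihomog mdeg (e - d) c else 0).
split; [exact: gI | by case: ifP => _; [apply: gJ | case: idJ] |].
rewrite raddfD /=; congr (_ + _); rewrite !pihE !(truncM _ _ hf).
case: ifP => de; last by rewrite (_ : e.+1 - d = e - d)%N ?subrr ?mulr0 //; lia.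
by rewrite subSn // -mulrBr.
Qed.

(** f^N c has no component of degree below N, so for N = [msize u] truncation keeps only [u]. *)
Lemma graded_separated I f d u :
  graded_ideal I -> (0 < d)%N -> f \is d.-homog ->
  (forall N, exists c, I (u - f ^+ N * c)) -> I u.
Proof.
move=> gI d0 hf sep; have [c Ic] := sep (msize u).
have := trunc_graded (msize u) gI Ic.
rewrite raddfB /= trunc_ge // (truncM _ _ (dhomogMn _ hf)).
rewrite (_ : _ - _ = 0)%N ?trunc0 ?mulr0 ?subr0 //.
by apply/eqP; rewrite subn_eq0 leq_pmull.
Qed.

(** Iterating the inclusion puts J into I + f^N J for every N. *)
Lemma graded_nakayama I J f d :
  graded_ideal I -> (0 < d)%N -> f \is d.-homog ->
  sub_pred J (add_mul I f J) -> sub_pred J I.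
Proof.
move=> gI d0 hf JI u Ju; apply: (graded_separated gI d0 hf).
have [idI _] := gI; suff S N : exists2 c, J c & I (u - f ^+ N * c).
  by move=> N; have [c _ Ic] := S N; exists c.
elim: N => [|N [c /JI[b [c' [Ib Jc' ->]]] Ic]].
  by exists u; rewrite // mul1r subrr; case: idI.
exists c' => //.
have -> : u - f ^+ N.+1 * c' = (u - f ^+ N * (b + f * c')) + f ^+ N * b.
  by rewrite exprS; ring.
by case: idI => _ ID IM; apply: ID => //; apply: IM.
Qed.

Definition homog_pos_seq (fs : seq {mpoly K[n]}) : Prop :=
  forall f, f \in fs -> homog_pos f.

Lemma weak_regular_seq_regular J I fs :
  graded_ideal I -> graded_ideal J -> homog_pos_seq fs ->
  ~ sub_pred J I -> weak_regular_seq J I fs -> regular_seq J I fs.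
Proof.
move=> + gJ; elim: fs I => [|f fs IH] I gI //= hfs nz [reg wreg]; split=> //.
have [d d0 hf] := hfs f (mem_head _ _).
apply: IH => //; first exact: graded_add_mul hf.
  by move=> g gfs; apply: hfs; rewrite inE gfs orbT.
by move=> JI; apply: nz; apply: graded_nakayama hf _.
Qed.

(* Unmixedness: depth M <= dim R/p for p associated to M.  The elements [w]   *)
(* killed by (I : u) do not all lie in I + f J, by Nakayama; a [w] that does  *)
(* not serves as the [u] of the next step.                                    *)
Lemma regular_seq_prime_chain J I fs u :
  graded_ideal I -> graded_ideal J -> sub_pred I J -> homog_pos_seq fs ->
  weak_regular_seq J I fs -> J u -> ~ I u ->
  prime_chain_above (fun s => I (s * u)) (size fs).
Proof.
move=> + gJ; elim: fs I u => [|f fs IH] I u gI IJ hfs /=.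
  move=> _ Ju Iu.
  have [||||Q [pQ IQ _]] := @prime_avoiding _ (fun s => I (s * u)) (fun s => s = 1).
  - exact: (is_ideal_colon u gI.1).
  - by [].
  - by move=> a b -> ->; rewrite mulr1.
  - by move=> a + a1; rewrite a1 mul1r.
  by exists (fun=> Q); split.
move=> [reg wreg] Ju nIu; have [d d0 hf] := hfs f (mem_head _ _).
have gfI := graded_add_mul gI gJ hf; have [idI _] := gI; have [idJ _] := gJ.
pose U w := J w /\ forall s, I (s * u) -> I (s * w).
have [w [[Jw Uw] nIw]] : exists w, U w /\ ~ add_mul I f J w.
  apply: NNPP => nex; apply: nIu.
  apply: (@graded_nakayama I U f d) => // w [Jw Uw].
  have [b [c [Ib Jc ew]]] : add_mul I f J w.
    by apply: NNPP => nw; apply: nex; exists w.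
  exists b, c; split=> //; split=> // s /Uw Isw.
  apply: reg; first by case: idJ => _ _; apply.
  have -> : f * (s * c) = s * w - s * b by rewrite ew; ring.
  by apply: idealB => //; case: idI => _ _; apply.
have [|P [P1 P2]] := IH _ w gfI (add_mul_sub idJ IJ) _ wreg Jw nIw.
  by move=> g gfs; apply: hfs; rewrite inE gfs orbT.
have [prP0 cP0] := P1 0%N isT; have [idP0 nP01 prM] := prP0.
have regN k s : I (s * f ^+ k * u) -> I (s * u).
  elim: k => [|k IHk]; first by rewrite mulr1.
  rewrite exprS => Ik; apply: IHk; apply: reg.
    by case: idJ => _ _; apply.
  by have -> : f * (s * f ^+ k * u) = s * (f * f ^+ k) * u by ring.
(* Localising at [P 0] and inverting [f] does not kill R/(I : u): [f] is regular, and whatever kills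
   [u] kills [w], hence lies in [P 0]. The prime obtained lies in [P 0] and misses [f]. *)
have [||||Q [pQ IQ avoid]] := @prime_avoiding _ (fun s => I (s * u))
    (fun a => exists s k, ~ P 0%N s /\ a = s * f ^+ k).
- exact: is_ideal_colon.
- by exists 1, 0%N; rewrite mulr1.
- move=> _ _ [s [k [ns ->]]] [t [l [nt ->]]]; exists (s * t), (k + l)%N.
  by split; [case/prM | rewrite exprD; ring].
- move=> a Ia [s [k [ns ea]]]; rewrite ea in Ia; apply/ns/cP0.
  exact/add_mul_l/Uw/(regN k).
have QP0 : sub_pred Q (P 0%N).
  move=> a Qa; apply: NNPP => na; apply: (avoid a Qa).
  by exists a, 0%N; rewrite mulr1.
have nQf : ~ Q f by move=> Qf; apply: (avoid f Qf); exists 1, 1%N; rewrite mul1r.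
have P0f : P 0%N f by apply: cP0; apply: add_mul_r.
exists (fun i => if i is i'.+1 then P i' else Q); split=> [[|i]|[|i]] //.
- move=> id; split; first exact: (P1 i id).1.
  move=> s Isu; apply: (P1 i id).2; apply: add_mul_l => //; exact: Uw.
- by move=> _; split=> // /(_ f P0f).
- exact: P2.
Qed.

(* Truncation of the Koszul complex, in the grading shifted by the degrees    *)
(* [ds] so that the differential is homogeneous of degree zero.               *)
Fixpoint ktrunc k (ds : seq nat) E : kos {mpoly K[n]} k -> kos {mpoly K[n]} k :=
  match k return kos {mpoly K[n]} k -> kos {mpoly K[n]} k with
  | 0 => fun z => trunc E z
  | k'.+1 => fun z => (ktrunc (behead ds) (E - head 0 ds)%N z.1,
                       ktrunc (behead ds) E z.2)
  end.

Lemma ktruncB k ds E : {morph @ktrunc k ds E : y z / y - z}.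
Proof.
elim: k ds E => [|k IH] ds E y z /=; first exact: truncB.
rewrite !IH; reflexivity.
Qed.

Lemma ktrunc_koch k ds E I j (z : kos {mpoly K[n]} k) :
  graded_ideal I -> koch I j z -> koch I j (ktrunc ds E z).
Proof.
move=> gI; elim: k ds E j z => [|k IH] ds E j z /=.
  by case: eqP => [_|_ ->]; [apply: trunc_graded | rewrite raddf0].
by case=> ? ?; split; apply: IH.
Qed.

Lemma ktrunc_scale k ds E d g (z : kos {mpoly K[n]} k) :
  g \is d.-homog -> ktrunc ds E (g *: z) = g *: ktrunc ds (E - d) z.
Proof.
move=> hg; elim: k ds E z => [|k IH] ds E z /=; first exact: truncM.
rewrite !IH subnAC; reflexivity.
Qed.

Lemma ktrunc0 k ds (z : kos {mpoly K[n]} k) : ktrunc ds 0 z = 0.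
Proof. by elim: k ds z => [|k IH] ds z /=; [exact: trunc0 | rewrite !IH]. Qed.

Lemma ktrunc_large k ds (z : kos {mpoly K[n]} k) :
  exists E0, forall E, (E0 <= E)%N -> ktrunc ds E z = z.
Proof.
elim: k ds z => [|k IH] ds z /=; first by exists (msize z) => E; apply: trunc_ge.
case: z => a b; have [E1 h1] := IH (behead ds) a; have [E2 h2] := IH (behead ds) b.
by exists (head 0 ds + E1 + E2)%N => E hE /=; rewrite h1 ?h2 //; lia.
Qed.

Fixpoint homog_degs (gs : seq {mpoly K[n]}) (ds : seq nat) : Prop :=
  if gs is g :: gs' then
    [/\ (0 < head 0 ds)%N, g \is (head 0%N ds).-homog & homog_degs gs' (behead ds)]
  else True.

Lemma homog_degsP gs : homog_pos_seq gs -> exists ds, homog_degs gs ds.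
Proof.
elim: gs => [|g gs IH] hgs; first by exists [::].
have [d d0 hg] := hgs g (mem_head _ _).
have [|ds hds] := IH; last by exists (d :: ds).
by move=> f fgs; apply: hgs; rewrite inE fgs orbT.
Qed.

Lemma kosd_ktrunc gs ds E (z : kos {mpoly K[n]} (size gs)) :
  homog_degs gs ds -> kosd (ktrunc ds E z) = ktrunc ds E (kosd z).
Proof.
elim: gs ds E z => [|g gs IH] ds E z /=; first by rewrite raddf0.
case=> _ hg hds; rewrite ktruncB !IH // (ktrunc_scale _ _ _ hg); reflexivity.
Qed.

(** By the cone structure, vanishing for [g :: gs] makes g surjective on H^i(gs; M) for i < k. A
    graded Nakayama argument on cochains then gives zero. *)
Lemma kos_vanish_tail J I g gs k :
  graded_ideal I -> graded_ideal J -> sub_pred I J -> homog_pos_seq (g :: gs) ->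
  kos_vanish J I (g :: gs) k.+1 -> kos_vanish J I gs k.
Proof.
move=> gI gJ IJ hgs van j z jk Jz Idz.
have [idI _] := gI; have [idJ _] := gJ.
have [I0 _ _] := idI; have [J0 _ _] := idJ.
have [|ds hds] := @homog_degsP gs.
  by move=> f fgs; apply: hgs; rewrite inE fgs orbT.
have [d d0 hg] := hgs g (mem_head _ _).
have step (y : kos {mpoly K[n]} (size gs)) : koch J j y -> koch I j.+1 (kosd y) ->
    exists a b : kos {mpoly K[n]} (size gs),
    [/\ koch J j a, koch I j.+1 (kosd a), koch J j.-1 b
      & koch I j (y - (g *: a - kosd b))].
  move=> Jy Idy; have [] := van j.+1 (0, y) => //=.
  - by split=> //; apply: koch_zero.
  - rewrite scaler0 sub0r kosd0; split; first exact: koch_zero.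
    exact: kochN.
  case=> a b [/= Ja Jb] [Ia Ib]; exists a, b; split=> //.
  by rewrite -[kosd a]opprK -[- kosd a]sub0r; apply: kochN.
have iter N : exists a b : kos {mpoly K[n]} (size gs),
    [/\ koch J j a, koch I j.+1 (kosd a), koch J j.-1 b
    & koch I j (z - (g ^+ N *: a - kosd b))].
  elim: N => [|N [a [b [Ja Ida Jb Iz]]]].
    exists z, 0; split=> //; first exact: koch_zero.
    by rewrite scale1r kosd0 subr0 subrr; apply: koch_zero.
  have [a' [b' [Ja' Ida' Jb' Ia]]] := step a Ja Ida.
  exists a', (g ^+ N *: b' + b); split=> //.
    by apply: kochD => //; apply: kochZ.
  have -> : z - (g ^+ N.+1 *: a' - kosd (g ^+ N *: b' + b)) =
    z - (g ^+ N *: a - kosd b) + g ^+ N *: (a - (g *: a' - kosd b')).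
    rewrite kosdD kosdZ exprSr -scalerA !scalerBr !opprB -!addrA addKr.
    by congr (_ + _); rewrite addrCA.
  by apply: kochD => //; apply: kochZ.
(* Truncation at [E0] fixes [z] and removes g^E0 a, so [z] is a boundary modulo [I]. *)
have [E0 hE0] := ktrunc_large ds z; have [a [b [Ja Ida Jb Iz]]] := iter E0.
exists (- ktrunc ds E0 b); first by apply: kochN => //; apply: ktrunc_koch.
have := ktrunc_koch ds E0 gI Iz.
rewrite !ktruncB hE0 // (ktrunc_scale _ _ _ (dhomogMn _ hg)).
rewrite (_ : _ - _ = 0)%N; last by apply/eqP; rewrite subn_eq0 leq_pmull.
by rewrite ktrunc0 scaler0 sub0r kosdN !opprK -kosd_ktrunc.
Qed.

(** * Top Koszul cohomology and the return to regular sequences *)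

Fixpoint kos_top k (u : {mpoly K[n]}) : kos {mpoly K[n]} k :=
  if k is k'.+1 then (0, kos_top k' u) else u.

Lemma kos_topB k : {morph @kos_top k : u v / u - v}.
Proof. by elim: k => //= k IH u v; rewrite IH -[in LHS](subrr 0). Qed.

Lemma kos_topZ k g u : kos_top k (g * u) = g *: kos_top k u.
Proof. by elim: k => //= k ->; rewrite -[in LHS](scaler0 _ g). Qed.

Lemma koch_top I k u : I 0 -> koch I k.+1 (kos_top k u) <-> I u.
Proof.
move=> I0; elim: k => //= k <-; split; first by case.
by split=> //; apply: koch_zero.
Qed.

Lemma koch_topE I k (z : kos {mpoly K[n]} k) :
  koch I k.+1 z -> exists2 u, I u & z = kos_top k u.
Proof.
elim: k z => [|k IH] z /=; first by exists z.
by case: z => a b /= [/koch_gt -> // /IH[u Iu ->]]; exists u.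
Qed.

Lemma kosd_top gs u : @kosd _ gs (kos_top (size gs) u) = 0.
Proof.
have idw : is_ideal (@whole {mpoly K[n]}) by [].
by apply: (koch_gt (ltnSn _) (kosd_koch idw _)); apply/koch_top.
Qed.

(** Top Koszul cohomology is M/(gs)M. *)
Lemma kos_top_boundary J I gs u :
  is_ideal I -> is_ideal J -> sub_pred I J -> J u ->
  (exists2 w, koch J (size gs) w & koch I (size gs).+1 (kos_top _ u - @kosd _ gs w))
  <-> quot_seq J I gs u.
Proof.
move=> idI idJ IJ; have [I0 _ _] := idI; have [J0 _ JM] := idJ.
elim: gs u => [|g gs IH] u Ju /=.
  split=> [[w _]|Iu]; first by rewrite subr0.
  by exists 0; rewrite ?subr0.
split.
  case=> -[a b] [/= /koch_topE[c Jc ->] Jb] [_ Iu].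
  exists (u - g * c), c; split=> //; last by rewrite subrK.
  apply/IH; first by apply: idealB => //; apply: JM.
  exists (- b); first exact: kochN.
  have -> : kos_top _ (u - g * c) - @kosd _ gs (- b) =
            kos_top _ u - (g *: kos_top _ c - kosd b).
    by rewrite kosdN opprK kos_topB kos_topZ opprB addrA addrAC.
  exact: Iu.
case=> q [c [Qq Jc eu]].
have Jq : J q.
  have -> : q = u - g * c by rewrite eu addrK.
  by apply: idealB => //; apply: JM.
have [w Jw Iw] := (IH q Jq).2 Qq.
exists (kos_top _ c, - w); first by split; [apply/koch_top | apply: kochN].
split=> /=; first by rewrite kosd_top subr0; apply: koch_zero.
by rewrite -kos_topZ kosdN opprK opprD addrA -kos_topB eu addrK.
Qed.

(** If g u lies in (gs)M, then u completes to a cocycle of the cone one degree below the top; being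
    a boundary, it shows that u lies in (gs)M. The reversal reflects that the cone adds the head of
    the list last. *)
Lemma kos_vanish_wreg J I gs :
  graded_ideal I -> graded_ideal J -> sub_pred I J -> homog_pos_seq gs ->
  kos_vanish J I gs (size gs) -> weak_regular_seq J I (rev gs).
Proof.
move=> gI gJ IJ; have [idI _] := gI; have [idJ _] := gJ.
have [I0 _ _] := idI; have [J0 _ JM] := idJ.
elim: gs => //= g gs IH hgs van; rewrite rev_cons weak_regular_seq_rcons revK.
split.
  apply: IH; last exact: (kos_vanish_tail gI gJ IJ hgs).
  by move=> f fgs; apply: hgs; rewrite inE fgs orbT.
move=> u Ju /kos_top_boundary[||||w Jw Iw] //; first exact: JM.
have [||[a b] [/= Ja Jb] [Ia _]] := van (size gs).+1 (kos_top _ u, w) (leqnn _).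
- by split=> //=; apply/koch_top.
- rewrite /= kosd_top -kos_topZ; split=> //; exact: koch_zero.
by apply/kos_top_boundary => //; exists a.
Qed.

Theorem weak_regular_seq_exchange J I fs gs :
  graded_ideal I -> graded_ideal J -> sub_pred I J -> homog_pos_seq gs ->
  size gs = size fs -> weak_regular_seq J I fs ->
  (forall f, f \in fs -> exists N f' r, [/\ in_span gs f', ann J I r
                                        & f ^+ N = f' + r]) ->
  weak_regular_seq J I (rev gs).
Proof.
move=> gI gJ IJ hgs sz wreg span; apply: kos_vanish_wreg => //; rewrite sz.
by apply: kos_vanish_regular => //; [case: gI | case: gJ].
Qed.

End Truncation.

(** * Polynomial substitutions *)

(** A regular sequence yields a prime chain of its own length, so one that reaches the dimension
    bound settles both dimension and depth. *)
Lemma CM_module_criterion (K : fieldType) n (J I : {mpoly K[n]} -> Prop) d fs :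
  graded_ideal I -> graded_ideal J -> sub_pred I J -> homog_pos_seq fs ->
  size fs = d -> regular_seq J I fs ->
  (forall e, has_prime_chain J I e -> (e <= d)%N) ->
  krull_dim J I d /\ CM_module J I.
Proof.
move=> gI gJ IJ hfs szfs reg dimd.
have depth gs : homog_pos_seq gs -> regular_seq J I gs ->
    has_prime_chain J I (size gs).
  move=> hgs rgs; have [idJ _] := gJ.
  have [u [Ju nIu]] : exists u, J u /\ ~ I u.
    apply: NNPP => nex; apply: (regular_seq_nonzero idJ rgs) => u Ju.
    by apply: NNPP => nI; apply: nex; exists u.
  have := regular_seq_prime_chain gI gJ IJ hgs (regular_seq_weak rgs) Ju nIu.
  by apply: prime_chain_above_sub => s; apply.
have kd : krull_dim J I d by split=> //; rewrite -szfs; apply: depth.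
split=> //; exists d => //; split; first by exists fs.
by move=> e [gs [<- hgs rgs]]; apply/dimd/depth.
Qed.

Section Substitution.
Variable K : fieldType.
Implicit Types V W : finType.

Definition var V (v : V) : {mpoly K[#|V|]} := 'X_(enum_rank v).

Definition subst V n (h : V -> {mpoly K[n]}) : {mpoly K[#|V|]} -> {mpoly K[n]} :=
  mmap (@mpolyC n K) (fun i => h (enum_val i)).

HB.instance Definition _ V n h :=
  GRing.RMorphism.copy (@subst V n h) (mmap (@mpolyC n K) (fun i => h (enum_val i))).

Lemma subst_var V n (h : V -> {mpoly K[n]}) v : subst h (var v) = h v.
Proof. by rewrite /subst /var mmapX mmap1U enum_rankK. Qed.

Lemma substC V n (h : V -> {mpoly K[n]}) c : subst h c%:MP = c%:MP.
Proof. exact: mmapC. Qed.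

Lemma rmorph_mpoly_congr V (B : comNzRingType) (Q : B -> Prop)
    (f g : {rmorphism {mpoly K[#|V|]} -> B}) p :
  is_ideal Q -> (forall c, f c%:MP = g c%:MP) ->
  (forall v, Q (f (var v) - g (var v))) -> Q (f p - g p).
Proof.
move=> idQ fgC fgX; have [Q0 QD QM] := idQ; pose C q := Q (f q - g q).
have CM q r : C q -> C r -> C (q * r).
  move=> Cq Cr; rewrite /C !rmorphM.
  have -> : f q * f r - g q * g r = f q * (f r - g r) + g r * (f q - g q) by ring.
  by apply: QD; apply: QM.
have CC c : C c%:MP by rewrite /C fgC subrr.
rewrite [p]mpolyE (raddf_sum f) (raddf_sum g) -sumrB; apply: ideal_sum => // m _.
rewrite -mul_mpolyC; apply: (CM _ _ (CC _)); rewrite mpolyXE_id.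
apply: (big_ind C) => [|//|i _]; first exact: (CC 1).
rewrite -[i]enum_valK; elim: (m _) => [|k IH]; first exact: (CC 1).
by rewrite exprS; apply: CM => //; apply: fgX.
Qed.

Lemma eq_rmorph_mpoly V (B : comNzRingType)
    (f g : {rmorphism {mpoly K[#|V|]} -> B}) :
  (forall c, f c%:MP = g c%:MP) -> (forall v, f (var v) = g (var v)) -> f =1 g.
Proof.
move=> fgC fgX p; apply: subr0_eq.
apply: (rmorph_mpoly_congr (Q := fun a => a = 0)) => // [|v].
  split=> // [a b -> ->|r a ->]; [exact: addr0 | exact: mulr0].
by rewrite fgX subrr.
Qed.

Lemma eq_subst V n (f g : V -> {mpoly K[n]}) : f =1 g -> subst f =1 subst g.
Proof.
move=> fg; apply: (eq_rmorph_mpoly (f := subst f) (g := subst g)) => [c|v] /=.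
  by rewrite !substC.
by rewrite !subst_var.
Qed.

Lemma subst_id V (f : V -> {mpoly K[#|V|]}) p :
  (forall v, f v = var v) -> subst f p = p.
Proof.
move=> fv; apply: (eq_rmorph_mpoly (g := idfun)) => [c|v] /=.
  exact: substC.
by rewrite subst_var.
Qed.

Lemma subst_comp V W n (h : V -> {mpoly K[#|W|]}) (k : W -> {mpoly K[n]}) p :
  subst k (subst h p) = subst (fun v => subst k (h v)) p.
Proof.
move: p; apply: (eq_rmorph_mpoly (f := subst k \o subst h)) => [c|v] /=.
  by rewrite !substC.
by rewrite !subst_var.
Qed.

Lemma subst_homog V n (h : V -> {mpoly K[n]}) k d p :
  (forall v, h v \is k.-homog) -> p \is d.-homog -> subst h p \is (k * d).-homog.
Proof.
move=> hh /dhomogP hp; rewrite [p]mpolyE raddf_sum /= big_seq.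
apply: rpred_sum => m /hp <-; rewrite -mul_mpolyC rmorphM /= substC mul_mpolyC.
apply: rpredZ; rewrite mpolyXE_id rmorph_prod /= mdegE big_distrr /=.
elim/big_rec2: _ => [|i e q _ IH]; first exact: dhomog1.
apply: dhomogM => //; rewrite rmorphXn /=; apply: dhomogMn.
by rewrite -[i]enum_valK subst_var.
Qed.

Lemma subst_pihomog V n (h : V -> {mpoly K[n]}) d p :
  (forall v, h v \is 1.-homog) ->
  pihomog mdeg d (subst h p) = subst h (pihomog mdeg d p).
Proof.
move=> hh; pose k := maxn d.+1 (msize p).
have hom e : subst h (pihomog mdeg e p) \is e.-homog.
  by rewrite -[X in X.-homog]mul1n; apply: subst_homog => //; apply: pihomogP.
have -> : subst h p = \sum_(i < k) subst h (pihomog mdeg i p).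
  rewrite -(rmorph_sum (subst h)) -pihomog_partitionE // leq_maxr //.
have dk : (d < k)%N by rewrite leq_maxl.
rewrite (raddf_sum (pihomog mdeg d)) (bigD1 (Ordinal dk)) //=.
rewrite (pihomog_dE (hom d)) big1 ?addr0 // => i.
by rewrite -val_eqE /= => ne; apply: (pihomog_ne0 ne); apply: hom.
Qed.

Definition supp V (m : 'X_{1..#|V|}) : {set V} := [set v | 0 < m (enum_rank v)]%N.

Definition ev V (F : {set V}) := subst (fun v => if v \in F then var v else 0).

HB.instance Definition _ V F :=
  GRing.RMorphism.copy (@ev V F) (subst (fun v => if v \in F then var v else 0)).

Lemma ev_var V (F : {set V}) v : ev F (var v) = if v \in F then var v else 0.
Proof. exact: subst_var. Qed.

Lemma evX V (F : {set V}) m :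
  ev F 'X_[m] = if supp m \subset F then 'X_[m] else 0.
Proof.
rewrite mpolyXE_id rmorph_prod /=; case: ifP => [mF|/negbT/subsetPn[v]].
  apply: eq_bigr => i _; rewrite rmorphXn /= -[i]enum_valK ev_var.
  case: ifP => // /negbT; apply: contraNeq => nz.
  apply: (subsetP mF); rewrite inE.
  by case: (m _) nz => //; rewrite !expr0 eqxx.
rewrite inE => mv vF; rewrite (bigD1 (enum_rank v)) //= rmorphXn /=.
by rewrite [ev F _]ev_var (negbTE vF) expr0n eqn0Ngt mv mul0r.
Qed.

Lemma mcoeff_ev V (F : {set V}) p m :
  (ev F p)@_m = if supp m \subset F then p@_m else 0.
Proof.
elim/mpolyind: p => [|c k p _ _ IH]; first by rewrite raddf0 mcoeff0 if_same.
rewrite raddfD /= !mcoeffD IH -mul_mpolyC rmorphM /= [ev F _%:MP]substC.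
rewrite !mul_mpolyC evX !mcoeffZ (fun_if (mcoeff m)) mcoeff0 mcoeffX.
case: (k =P m) => [->|_]; first by case: ifP => _; rewrite ?mulr0 ?addr0.
by rewrite !if_same mulr0 !add0r.
Qed.

(* The multiplier is the positive [a.+1], so that the result is finite. *)
Definition pull n a (u : 'X_{1..n}) (p : {mpoly K[n]}) : {mpoly K[n]} :=
  \sum_(m : 'X_{1..n < msize p}) p@_(m *+ a.+1 + u) *: 'X_[m].

Lemma mcoeff_pull n a u (p : {mpoly K[n]}) m :
  (pull a u p)@_m = p@_(m *+ a.+1 + u).
Proof.
have [lt|ge] := ltnP (mdeg m) (msize p).
  by rewrite (mcoeff_mpoly (fun m => p@_(m *+ a.+1 + u))).
rewrite /pull raddf_sum /= big1 => [|k _].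
  apply/esym/memN_msupp_eq0/negP => /msize_mdeg_lt.
  rewrite mdegD mdegMn; nia.
rewrite mcoeffZ mcoeffX; case: eqP => [e|_]; last by rewrite mulr0.
by have := bmdeg k; rewrite e; lia.
Qed.

Lemma pullB n a u : {morph @pull n a u : p q / p - q}.
Proof. by move=> p q; apply/mpolyP=> m; rewrite mcoeffB !mcoeff_pull mcoeffB. Qed.

HB.instance Definition _ n a u :=
  GRing.isZmodMorphism.Build {mpoly K[n]} {mpoly K[n]} (pull a u) (@pullB n a u).

Lemma mcoeffXM n (p : {mpoly K[n]}) k m :
  ('X_[k] * p)@_m = if (k <= m)%MM then p@_(m - k) else 0.
Proof.
case: ifP => [km|/negP nkm].
  by rewrite -{1}(submK km) addmC mulrC mcoeffMX.
apply/memN_msupp_eq0; rewrite mulrC (perm_mem (msuppMX _ _)).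
by apply/mapP => -[m' _ e]; apply: nkm; rewrite e lem_addr.
Qed.

End Substitution.

(** * Squarefree monomial ideals *)

Lemma pred_ext T (A B : T -> Prop) : same_pred A B -> A = B.
Proof. by move=> AB; apply: boolp.funext => a; apply: boolp.propext. Qed.

Section FaceIdeals.
Variables (K : fieldType) (V : finType).
Implicit Types (F : {set V}) (Phi Psi : {set V} -> Prop).
Local Notation S := {mpoly K[#|V|]}.
Implicit Types (p q : S).

Lemma var_homog (v : V) : var K v \is 1.-homog.
Proof. by rewrite dhomogX; apply/eqP/mdeg1. Qed.

Lemma var_neq0 (v : V) : var K v != 0.
Proof.
apply/eqP => /(congr1 (mcoeff U_(enum_rank v))); rewrite mcoeffX eqxx mcoeff0.
by move/eqP; rewrite oner_eq0.
Qed.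

(* The kernel of [ev F] is the prime ideal generated by the [x_v], v not in   *)
(* F; the intersections of such kernels are the squarefree monomial ideals.   *)
Definition face_ideal Phi p : Prop := forall F, Phi F -> ev F p = 0.

Lemma is_ideal_face_ideal Phi : is_ideal (face_ideal Phi).
Proof.
split=> [F _|p q Ip Iq F PF|r p Ip F PF]; first by rewrite rmorph0.
  by rewrite rmorphD /= Ip // Iq // addr0.
by rewrite rmorphM /= Ip // mulr0.
Qed.

Lemma graded_face_ideal Phi : graded_ideal (face_ideal Phi).
Proof.
split; first exact: is_ideal_face_ideal.
move=> p Ip d F PF; rewrite /ev -subst_pihomog ?[subst _ _](Ip F PF) ?raddf0 //.
by move=> v; case: ifP => _; [exact: var_homog | exact: dhomog0].
Qed.

Lemma face_prime F : is_prime_ideal (fun p : S => ev F p = 0).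
Proof.
split; first split.
- by rewrite rmorph0.
- by move=> a b ea eb; rewrite rmorphD /= ea eb addr0.
- by move=> r a ea; rewrite rmorphM /= ea mulr0.
- by rewrite rmorph1 => /eqP; rewrite oner_eq0.
- by move=> a b /eqP; rewrite rmorphM mulf_eq0 => /orP[]/eqP; [left | right].
Qed.

Lemma ev_ev (F F' : {set V}) p : ev F (ev F' p) = ev (F :&: F') p.
Proof.
rewrite /ev subst_comp; apply: eq_subst => v; rewrite inE andbC.
by case: (v \in F') => /=; rewrite ?subst_var ?rmorph0.
Qed.

Lemma ev_sub (F F' : {set V}) p : F \subset F' -> ev F' p = 0 -> ev F p = 0.
Proof. by move=> /setIidPl <- ep; rewrite -ev_ev ep rmorph0. Qed.

(** Removing the vertices of [F] one at a time adds one variable to the kernel at each step. *)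
Lemma face_prime_chain F : prime_chain_above (fun p : S => ev F p = 0) #|F|.
Proof.
pose A i := [set v in drop i (enum F)].
have subA i j : (i <= j)%N -> A j \subset A i.
  move=> ij; apply/subsetP => v; rewrite !inE -(subnK ij) -drop_drop.
  exact: mem_drop.
exists (fun i p => ev (A i) p = 0); split=> i iF.
  split; first exact: face_prime.
  move=> p; apply: ev_sub; apply: (subset_trans (subA 0 i (leq0n _)) _).
  by apply/subsetP => v; rewrite inE drop0 mem_enum.
split; first by move=> p; apply/ev_sub/subA.
have i_lt : (i < size (enum F))%N by rewrite -cardE.
have [v0 _] : exists v : V, true.
  by case: (enum F) i_lt => // v; exists v.
pose v := nth v0 (enum F) i.
move=> /(_ (var K v)); rewrite !ev_var !inE (drop_nth v0 i_lt) mem_head.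
suff /negbTE -> : v \notin drop i.+1 (enum F).
  by move=> /(_ erefl)/eqP; rewrite (negbTE (var_neq0 v)).
have := drop_uniq i (enum_uniq F); by rewrite (drop_nth v0 i_lt) => /andP[].
Qed.

Lemma ev_face_monomial (F A : {set V}) :
  ev F (face_monomial K A) = if A \subset F then face_monomial K A else 0.
Proof.
rewrite /face_monomial rmorph_prod /=; case: ifP => [AF|/negbT/subsetPn[v vA vF]].
  by apply: eq_bigr => v /(subsetP AF) vF; rewrite [LHS]ev_var vF.
by rewrite (bigD1 v) //= [ev _ _]ev_var (negbTE vF) mul0r.
Qed.

Lemma face_monomial_dvd m : exists q, 'X_[m] = q * face_monomial K (supp m).
Proof.
exists (\prod_v var K v ^+ (m (enum_rank v)).-1).
rewrite mpolyXE_id (reindex (@enum_rank V)) /=; last first.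
  by apply: onW_bij; apply: enum_rank_bij.
rewrite /face_monomial (big_mkcond (mem (supp m))) -big_split /=.
apply: eq_bigr => v _; rewrite inE; case: (m _) => [|k] /=.
  by rewrite expr0 mulr1.
by rewrite exprSr.
Qed.

(** Both sides are spanned by the monomials whose support is a nonface: [ev F] keeps exactly the
    monomials supported in [F], and a monomial is a multiple of the squarefree one on its
    support. *)
Lemma SR_idealE (D : {set {set V}}) :
  (forall F F', F \subset F' -> F' \in D -> F \in D) ->
  @SR_ideal K V D = face_ideal (fun F => F \in D).
Proof.
move=> downD; apply: pred_ext => p; split=> [Ip|ep].
  apply: Ip; first exact: is_ideal_face_ideal.
  move=> _ [F FD ->] F' F'D; rewrite ev_face_monomial.
  by case: ifP => // FF'; rewrite (downD _ _ FF' F'D) in FD.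
move=> I idI gI; rewrite [p]mpolyE big_seq; apply: ideal_sum => // m mp.
have [_ _ IM] := idI; rewrite -mul_mpolyC; apply: (IM).
have [q ->] := face_monomial_dvd m; apply: (IM); apply: gI.
exists (supp m) => //; apply/negP => mD.
have := congr1 (mcoeff m) (ep _ mD); rewrite mcoeff_ev subxx mcoeff0.
by apply/eqP; rewrite -mcoeff_msupp.
Qed.

(** * Elementary symmetric polynomials *)

Definition elem_sym k : S := \sum_(F : {set V} | #|F| == k) face_monomial K F.

Lemma elem_sym_homog k : elem_sym k \is k.-homog.
Proof.
apply: rpred_sum => F /eqP <-.
have -> : #|F| = (\sum_(v in F) 1)%N by rewrite sum1_card.
elim/big_rec2: (face_monomial K F) => [|v d p _ hp]; first exact: dhomog1.
by apply: dhomogM => //; apply: var_homog.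
Qed.

Lemma ev_elem_sym F k : (#|F| < k)%N -> ev F (elem_sym k) = 0.
Proof.
move=> Fk; rewrite rmorph_sum /= big1 // => A /eqP cA; rewrite ev_face_monomial.
by case: ifP => // /subset_leq_card; rewrite cA leqNgt Fk.
Qed.

(* [x_u] is a root of the monic polynomial with roots the [x_v]. *)
Lemma var_integral (I : S -> Prop) u :
  is_ideal I -> (forall k, (0 < k)%N -> I (elem_sym k)) -> I (var K u ^+ #|V|).
Proof.
move=> idI Ie; pose t := var K u.
have : \prod_(v : V) (- var K v + t) = 0.
  by rewrite (bigD1 u) //= addNr mul0r.
have -> : \prod_v (- var K v + t) = \sum_(J : {set V})
    (-1) ^+ #|J| * face_monomial K J * t ^+ (#|V| - #|J|).
  rewrite bigA_distr; apply: eq_bigr => J _.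
  have -> : (#|V| - #|J| = #|~: J|)%N by rewrite [RHS]cardsCs setCK.
  rewrite (bigID (mem J)) /=; congr (_ * _).
    rewrite -prodr_const -big_split /=.
    by apply: eq_bigr => v ->; rewrite mulN1r.
  rewrite -prodr_const; apply: eq_big => [v|v /negbTE ->//]; by rewrite inE.
(* The empty set contributes the power of x_u; the other terms, grouped by cardinality k > 0, are
   multiples of e_k. *)
rewrite (bigD1 set0) //= cards0 subn0 /face_monomial big_set0 expr0 !mul1r.
move/eqP; rewrite addr_eq0 => /eqP ->; apply: idealN => //.
rewrite (partition_big (fun J : {set V} => inord #|J| : 'I_#|V|.+1) (fun k => k != 0 :> nat)) /=.
  apply: ideal_sum => // k k0.
  have -> : \sum_(J : {set V} | (J != set0) && (inord #|J| == k))
     (-1) ^+ #|J| * face_monomial K J * t ^+ (#|V| - #|J|) =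
     ((-1) ^+ k * t ^+ (#|V| - k)) * elem_sym k.
    rewrite /elem_sym mulr_sumr; apply: eq_big => J.
      rewrite -[inord _ == _]val_eqE /= inordK ?ltnS ?max_card // andb_idl // => /eqP cJ.
      by apply: contraNneq k0 => J0; rewrite -cJ J0 cards0.
    case/andP=> _; rewrite -[inord _ == _]val_eqE /= inordK ?ltnS ?max_card // => /eqP ->.
    by rewrite mulrAC.
  by case: (idI) => _ _; apply; apply: Ie; rewrite lt0n.
by move=> J J0; rewrite inordK ?ltnS ?max_card // cards_eq0.
Qed.

End FaceIdeals.

(** * Squaring the variables *)

Section Span.
Variable R : comNzRingType.
Implicit Types (I : R -> Prop) (gs : seq R).

Lemma in_span0 gs : in_span gs 0.
Proof.
elim: gs => [|g gs IH]; first exact: in_span_nil.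
by have := in_span_cons g 0 IH; rewrite mul0r addr0.
Qed.

Lemma in_spanD gs a b : in_span gs a -> in_span gs b -> in_span gs (a + b).
Proof.
move=> Sa; elim: Sa b => [|g gs' c f _ IH] b Sb.
  by inversion Sb; rewrite addr0; apply: in_span_nil.
inversion Sb as [|g' gs'' c' f' Sf']; subst.
have -> : c * g + f + (c' * g + f') = (c + c') * g + (f + f') by ring.
by apply: in_span_cons; apply: IH.
Qed.

Lemma in_spanM gs r a : in_span gs a -> in_span gs (r * a).
Proof.
elim=> [|g gs' c f _ IH]; first by rewrite mulr0; apply: in_span_nil.
by rewrite mulrDr mulrA; apply: in_span_cons.
Qed.

Lemma in_span_mem gs g : g \in gs -> in_span gs g.
Proof.
elim: gs => // h gs IH; rewrite inE => /orP[/eqP ->|/IH Sg].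
  by rewrite -[X in in_span _ X]addr0 -[h in h + 0]mul1r; apply/in_span_cons/in_span0.
by have := in_span_cons h 0 Sg; rewrite mul0r add0r.
Qed.

Lemma is_ideal_span_add I gs :
  is_ideal I -> is_ideal (fun p => exists f r, [/\ in_span gs f, I r & p = f + r]).
Proof.
move=> [I0 ID IM]; split.
- by exists 0, 0; rewrite addr0; split=> //; apply: in_span0.
- move=> _ _ [f [r [Sf Ir ->]]] [f' [r' [Sf' Ir' ->]]]; exists (f + f'), (r + r').
  by rewrite addrACA; split; [apply: in_spanD | apply: ID |].
- move=> s _ [f [r [Sf Ir ->]]]; exists (s * f), (s * r).
  by rewrite mulrDr; split; [apply: in_spanM | apply: IM |].
Qed.

Lemma is_ideal_radical I : is_ideal I -> is_ideal (fun p => exists N, I (p ^+ N)).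
Proof.
move=> idI; have [I0 ID IM] := idI; split; first by exists 1%N.
- move=> a b [N Ia] [M Ib]; exists (N + M)%N; rewrite exprDn.
  apply: ideal_sum => // i _; rewrite -mulr_natr mulrC; apply: (IM).
  have [iM|iM] := leqP M i.
    by rewrite -(subnK iM) exprD mulrA; apply: (IM).
  have NM : (N <= N + M - i)%N by lia.
  by rewrite mulrC -(subnK NM) exprD mulrA; apply: IM.
- by move=> r a [N Ia]; exists N; rewrite exprMn; apply: IM.
Qed.

End Span.

(** * Regularity of elementary symmetric polynomials in squared variables *)

Section Frobenius.
Variables (K : fieldType) (V : finType).
Local Notation S := {mpoly K[#|V|]}.
Implicit Types (F : {set V}) (Phi Psi : {set V} -> Prop) (p q : S).

Lemma homog_pos_radical (I : S -> Prop) f :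
  is_ideal I -> (forall v, exists N, I (var K v ^+ N)) -> homog_pos f ->
  exists N, I (f ^+ N).
Proof.
move=> idI Iv [d d0 /dhomogP hf]; pose C p := exists N, I (p ^+ N).
have idR : is_ideal C := is_ideal_radical idI.
have [_ _ RM] := idR; rewrite -[exists N, _]/(C f) [f]mpolyE big_seq.
apply: ideal_sum => // m /hf dm; rewrite -mul_mpolyC; apply: (RM).
have [i mi] : exists i, (0 < m i)%N.
  apply/existsP; apply: contraTT d0 => /existsPn m0; rewrite -dm -[X in (_ < X)%N]/(mdeg m).
  by rewrite mdegE big1 // => i _; have := m0 i; case: (m i).
rewrite mpolyXE_id (bigD1 i) //= mulrC; apply: (RM).
by case: (m i) mi => // k _; rewrite exprSr -[i]enum_valK; apply: (RM); apply: Iv.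
Qed.

(* Squaring the variables makes [S] a free [S]-module with the squarefree     *)
(* monomials as basis, for which squarefree monomial ideals are graded.       *)
Definition frob : S -> S := subst (fun v => var K v ^+ 2).

HB.instance Definition _ :=
  GRing.RMorphism.copy frob (subst (fun v => var K v ^+ 2)).

Lemma ev_frob F p : ev F (frob p) = frob (ev F p).
Proof.
rewrite /ev /frob !subst_comp; apply: eq_subst => v; rewrite rmorphXn /= subst_var.
by case: ifP; rewrite ?subst_var ?rmorph0 ?expr0n.
Qed.

Lemma frobX m : frob 'X_[m] = 'X_[m *+ 2].
Proof.
rewrite [in LHS]mpolyXE_id rmorph_prod /= mpolyXE_id; apply: eq_bigr => i _.
rewrite rmorphXn /= -[i]enum_valK [frob _]subst_var /= enum_valK mulmnE.
by rewrite mulnC exprM /var enum_valK.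
Qed.

(** Collecting coefficients at the exponents 2m + u is linear over the squared variables: for
    squarefree [u], 2k <= 2m + u exactly when k <= m. *)
Lemma pull_frob (u : 'X_{1..#|V|}) g q :
  (forall i, u i <= 1)%N -> pull 1 u (frob g * q) = g * pull 1 u q.
Proof.
move=> u1; rewrite [g]mpolyE (raddf_sum frob) !mulr_suml raddf_sum /=.
apply: eq_bigr => k _; apply/mpolyP => m; rewrite mcoeff_pull.
rewrite -mul_mpolyC rmorphM /= [frob _%:MP]substC frobX -!mulrA !mcoeffCM.
rewrite !mcoeffXM mcoeff_pull; congr (_ * _).
have -> : (k *+ 2 <= m *+ 2 + u)%MM = (k <= m)%MM.
  apply/mnm_lepP/mnm_lepP => km i; move: (km i) (u1 i); rewrite mnmDE !mulmnE;
  by move: (u i) (k i) (m i) => a b c; lia.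
case: ifP => // /mnm_lepP km; congr (_ @_ _); apply/mnmP => i.
rewrite !(mnmDE, mnmBE, mulmnE); by move: (km i); move: (u i) (k i) (m i) => a b c; lia.
Qed.

(** [ev F] sees only supports, and the support of (a+1)m + u is the union of those of m and u. *)
Lemma ev_pull F a (u : 'X_{1..#|V|}) p :
  supp u \subset F -> ev F (pull a u p) = pull a u (ev F p).
Proof.
move=> uF; apply/mpolyP => m; rewrite mcoeff_ev !mcoeff_pull mcoeff_ev.
suff -> : (supp (m *+ a.+1 + u) \subset F) = (supp m \subset F) by [].
have -> : supp (m *+ a.+1 + u) = supp m :|: supp u.
  apply/setP => v; rewrite !inE mnmDE mulmnE addn_gt0 muln_gt0 andbT.
  by [].
by rewrite subUset uF andbT.
Qed.

(** Q = (gs) + ann(J/I) contains every e_k in the squared variables, k > 0. Hence the variables are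
    nilpotent modulo Q, and so are the members of a homogeneous regular sequence of length d;
    [weak_regular_seq_exchange] applies. *)
Lemma CM_frob_elem_sym_regular Phi Psi d :
  let I := face_ideal (K := K) Phi in let J := face_ideal Psi in
  sub_pred I J -> krull_dim J I d -> CM_module J I ->
  weak_regular_seq J I (map frob (mkseq (fun i => elem_sym K V i.+1) d)).
Proof.
move=> I J IJ [dch dmax] [d' [dch' dmax'] [[fs [szfs hfs rfs]] _]].
have {d' dch' dmax' szfs} szfs : size fs = d.
  by apply/eqP; rewrite szfs eqn_leq dmax // dmax'.
set gs := map _ _; have szgs : size gs = d by rewrite size_map size_mkseq.
have gI : graded_ideal I := graded_face_ideal K Phi.
have gJ : graded_ideal J := graded_face_ideal K Psi.
have idI := is_ideal_face_ideal K Phi : is_ideal I.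
pose Q p := exists f r, [/\ in_span (rev gs) f, ann J I r & p = f + r].
have idQ : is_ideal Q by apply/is_ideal_span_add/is_ideal_ann.
have Qe k : (0 < k)%N -> Q (frob (elem_sym K V k)).
  case: k => // k _; have [kd|dk] := ltnP k d.
    exists (frob (elem_sym K V k.+1)), 0; rewrite addr0; split=> //.
      apply: in_span_mem; rewrite mem_rev; apply: map_f; apply/mapP.
      by exists k; rewrite // mem_iota.
    by case: (is_ideal_ann J idI).
  exists 0, (frob (elem_sym K V k.+1)); rewrite add0r; split=> //; first exact: in_span0.
  move=> g Jg F PF; rewrite rmorphM /=.
  have [Fk|kF] := ltnP #|F| k.+1; first by rewrite ev_frob ev_elem_sym // rmorph0 mul0r.
  suff -> : ev F g = 0 by rewrite mulr0.
  (* Otherwise the prime of [F] contains the annihilator, and [face_prime_chain] exceeds the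
     dimension [d]. *)
  have [s [As sF]] : exists s, ann J I s /\ ev F s != 0.
    apply: NNPP => nex; have : (#|F| <= d)%N; last by lia.
    apply: dmax; apply: prime_chain_above_sub (face_prime_chain K F) => s As.
    by apply/eqP; apply: NNPP => /negP sF; apply: nex; exists s.
  have /eqP := As g Jg F PF; rewrite rmorphM mulf_eq0 (negbTE sF) /=.
  by move/eqP.
have Qv v : exists N, Q (var K v ^+ N).
  (* This power is the [frob] image of x_v to the [#|V|], so integrality is used for the preimage of
     Q. *)
  exists (2 * #|V|)%N; rewrite exprM -[_ ^+ 2](subst_var (fun v => var K v ^+ 2)).
  rewrite -[subst _ _]/(frob _) -rmorphXn /=.
  apply: (@var_integral K V (fun p => Q (frob p))) => //.
  have [Q0 QD QM] := idQ; split.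
  - by rewrite rmorph0.
  - by move=> a b; rewrite rmorphD; apply: QD.
  - by move=> a b; rewrite rmorphM; apply: QM.
rewrite -[gs]revK; apply: (weak_regular_seq_exchange gI gJ IJ (fs := fs)).
- move=> f; rewrite mem_rev => /mapP[_ /mapP[k _ ->] ->].
  exists (2 * k.+1)%N => //; apply: subst_homog; last exact: elem_sym_homog.
  by move=> v; apply: (dhomogMn 2 (var_homog K v)).
- by rewrite size_rev szgs szfs.
- exact: regular_seq_weak.
- by move=> f /hfs /(homog_pos_radical idQ Qv)[N [f' [r [? ? ?]]]]; exists N, f', r.
Qed.

End Frobenius.

(** * The fibre product *)

Section Twin.
Variables (K : fieldType) (V : finType) (x : V).
Local Notation S := {mpoly K[#|V|]}.
Local Notation V' := (Datatypes_option__canonical__fintype_Finite V).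
Local Notation S' := {mpoly K[#|V'|]}.
Implicit Types (F : {set V}) (Phi Psi : {set V} -> Prop) (p q : S) (a b : S').
Implicit Types (I J : S -> Prop).

(* [K[G']] is the fibre product of two copies of [K[G]] over [K[G]/(x)]; the  *)
(* projections are [twin0] and [twin1], and [twin_diag] is the diagonal.      *)
Definition twin0_var (w : V') : S := if w is Some v then var K v else 0.

Definition twin1_var (w : V') : S :=
  if w is Some v then if v == x then 0 else var K v else var K x.

Definition twin_diag_var (v : V) : S' :=
  @var K V' (Some v) + (if v == x then @var K V' None else 0).

Definition twin0 : S' -> S := subst twin0_var.
Definition twin1 : S' -> S := subst twin1_var.
Definition twin_diag : S -> S' := subst twin_diag_var.

HB.instance Definition _ := GRing.RMorphism.copy twin0 (subst twin0_var).
HB.instance Definition _ := GRing.RMorphism.copy twin1 (subst twin1_var).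
HB.instance Definition _ := GRing.RMorphism.copy twin_diag (subst twin_diag_var).

(** Takes the Stanley-Reisner ideal of G to that of G' ([SR_ideal_twin]), and likewise lifts each
    term of a filtration. *)
Definition twin_lift J a : Prop := J (twin0 a) /\ J (twin1 a).

Lemma twin0_diag p : twin0 (twin_diag p) = p.
Proof.
rewrite [LHS]subst_comp; apply: subst_id => v; rewrite /twin_diag_var rmorphD /= subst_var.
by case: ifP => _; rewrite ?subst_var ?rmorph0 addr0.
Qed.

Lemma twin1_diag p : twin1 (twin_diag p) = p.
Proof.
rewrite [LHS]subst_comp; apply: subst_id => v; rewrite /twin_diag_var rmorphD /= subst_var /=.
by case: eqP => [->|_]; rewrite ?subst_var ?rmorph0 ?addr0 ?add0r.
Qed.

Lemma is_ideal_twin_lift J : is_ideal J -> is_ideal (twin_lift J).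
Proof.
move=> [J0 JD JM]; split; first by split; rewrite rmorph0.
- by move=> a b [? ?] [? ?]; split; rewrite rmorphD; apply: JD.
- by move=> r a [? ?]; split; rewrite rmorphM; apply: JM.
Qed.

Lemma graded_twin_lift J : graded_ideal J -> graded_ideal (twin_lift J).
Proof.
move=> [idJ gJ]; split; first exact: is_ideal_twin_lift.
move=> a [Ja0 Ja1] d; split.
  rewrite /twin0 -subst_pihomog; first exact: gJ.
  by case=> [v|]; [exact: var_homog | exact: dhomog0].
rewrite /twin1 -subst_pihomog; first exact: gJ.
by case=> [v|] /=; [case: ifP => _; [exact: dhomog0 |] |]; exact: var_homog.
Qed.

(** * Splitting the fibre product as R + xR *)

Definition divx : S -> S := pull 0 U_(enum_rank x).

Lemma mul_divx p : var K x * divx p = p - ev [set~ x] p.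
Proof.
apply/mpolyP => m; rewrite mcoeffXM mcoeffB mcoeff_ev mcoeff_pull mulm1n.
have -> : (supp m \subset [set~ x]) = ~~ (U_(enum_rank x) <= m)%MM.
  rewrite lep1mP; apply/subsetP/idP => [sm|].
    by have := sm x; rewrite !inE eqxx; case: (m _) => // k /(_ isT).
  move=> mx v; rewrite !inE; apply: contraTneq => ->; move: mx.
  by case: (m _).
by case: ifP => [/submK ->|_]; rewrite ?subr0 ?subrr.
Qed.

Lemma ev_twin a : ev [set~ x] (twin0 a) = ev [set~ x] (twin1 a).
Proof.
rewrite /ev /twin0 /twin1 !subst_comp; apply: eq_subst => -[v|] /=.
  by case: eqP => [->|//]; rewrite subst_var rmorph0 !inE eqxx.
by rewrite rmorph0 subst_var !inE eqxx.
Qed.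

(** The component of [a] in xR is the difference of its projections; it is stored divided by x,
    exactly, since the projections agree modulo x. *)
Definition twin_diff a : S := divx (twin0 a - twin1 a).

Lemma mul_twin_diff a : var K x * twin_diff a = twin0 a - twin1 a.
Proof. by rewrite mul_divx rmorphB /= ev_twin subrr subr0. Qed.

Lemma twin_diffM t a : twin_diff (twin_diag t * a) = t * twin_diff a.
Proof.
apply: (mulfI (var_neq0 K x)); rewrite mulrCA !mul_twin_diff !rmorphM /=.
by rewrite twin0_diag twin1_diag mulrBr.
Qed.

Lemma twin_diffD : {morph twin_diff : a b / a + b}.
Proof.
move=> a b; apply: (mulfI (var_neq0 K x)); rewrite mulrDr !mul_twin_diff.
by rewrite !rmorphD /=; ring.
Qed.

Lemma twin_diff_face Phi a :
  twin_lift (face_ideal Phi) a -> face_ideal Phi (var K x * twin_diff a).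
Proof.
by move=> [I0 I1]; rewrite mul_twin_diff; exact: (idealB (is_ideal_face_ideal K Phi)).
Qed.

(** Both summands embed in J/I, a module through [frob]: p goes to [frob p] and x q to x times
    [frob q]. Extracting coefficients at the exponents 2m, respectively 2m plus that of x, retracts
    these maps, so regularity descends to the fibre product. *)
Lemma twin_weak_regular Phi Psi (gs : seq S) :
  weak_regular_seq (face_ideal Psi) (face_ideal Phi) (map (@frob K V) gs) ->
  weak_regular_seq (twin_lift (face_ideal Psi)) (twin_lift (face_ideal Phi))
    (map twin_diag gs).
Proof.
pose ux := U_(enum_rank x)%MM : 'X_{1..#|V|}.
have suppx : supp ux = [set x].
  apply/setP => v; rewrite !inE mnm1E (inj_eq enum_rank_inj) eq_sym.
  by case: eqP.
have supp0 : supp (0%MM : 'X_{1..#|V|}) = set0.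
  by apply/setP => v; rewrite !inE mnm0E.
have u0 (i : 'I_#|V|) : ((0%MM : 'X_{1..#|V|}) i <= 1)%N by rewrite mnm0E.
have u1 i : (ux i <= 1)%N by rewrite mnm1E; case: eqP.
have pull0_frob p : pull 1 0%MM (frob p) = p.
  have := pull_frob p 1 u0; rewrite mulr1 => ->.
  suff -> : pull 1 0%MM (1 : S) = 1 by rewrite mulr1.
  apply/mpolyP => m; rewrite mcoeff_pull !mcoeff1 addm0.
  by rewrite -!mdeg_eq0 mdegMn muln_eq0 orbF.
have pullx_frob p : pull 1 ux (var K x * frob p) = p.
  have := pull_frob p (var K x) u1; rewrite mulrC => ->.
  suff -> : pull 1 ux (var K x : S) = 1 by rewrite mulr1.
  apply/mpolyP => m; rewrite mcoeff_pull mcoeff1 mcoeffX.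
  by rewrite -{1}[U_(_)%MM]add0m eqm_add2r eq_sym -!mdeg_eq0 mdegMn muln_eq0 orbF.
have fr Xi p : face_ideal Xi p -> face_ideal Xi (frob p).
  by move=> Ip F PF; rewrite ev_frob Ip // rmorph0.
(* A face prime containing x p contains x or p, hence x or [frob p]. *)
have frx Xi p : face_ideal Xi (var K x * p) -> face_ideal Xi (var K x * frob p).
  move=> Ip F PF; have /eqP := Ip F PF; rewrite !rmorphM /= mulf_eq0.
  by rewrite ev_frob => /orP[]/eqP ->; rewrite ?rmorph0 ?mul0r ?mulr0.
have al1 Xi a : twin_lift (face_ideal Xi) a -> face_ideal Xi (frob (twin0 a)).
  by case=> /fr.
have al2 Xi a : twin_lift (face_ideal Xi) a ->
    face_ideal Xi (var K x * frob (twin_diff a)).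
  by move/twin_diff_face/frx.
have be1 Xi p : face_ideal Xi p ->
    twin_lift (face_ideal Xi) (twin_diag (pull 1 0%MM p)).
  move=> Ip; split; rewrite ?twin0_diag ?twin1_diag => F PF;
  by rewrite ev_pull ?supp0 ?sub0set // Ip // raddf0.
have be2 Xi p : face_ideal Xi p ->
    twin_lift (face_ideal Xi) (- (@var K V' None * twin_diag (pull 1 ux p))).
  move=> Ip; split; rewrite rmorphN rmorphM /= [_ (@var K V' None)]subst_var.
    by rewrite mul0r oppr0; case: (is_ideal_face_ideal K Xi).
  rewrite twin1_diag => F PF; rewrite rmorphN rmorphM /= ev_var.
  case: ifP => xF; last by rewrite mul0r oppr0.
  by rewrite ev_pull ?suppx ?sub1set // Ip // raddf0 mulr0 oppr0.
apply: (weak_regular_seq_transfer (phi := twin_diag) (psi := @frob K V)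
  (al1 := fun a => frob (twin0 a)) (al2 := fun a => var K x * frob (twin_diff a))
  (be1 := fun p => twin_diag (pull 1 0%MM p))
  (be2 := fun p => - (@var K V' None * twin_diag (pull 1 ux p)))) => //.
- by move=> a b; rewrite !rmorphD.
- by move=> a b; rewrite twin_diffD rmorphD mulrDr.
- by move=> p q; rewrite raddfD rmorphD.
- by move=> p q; rewrite raddfD rmorphD mulrDr opprD.
- exact/is_ideal_twin_lift/is_ideal_face_ideal.
- exact/is_ideal_twin_lift/is_ideal_face_ideal.
- by move=> t a; rewrite !rmorphM /= twin0_diag.
- by move=> t a; rewrite twin_diffM rmorphM mulrCA.
- by move=> t p; rewrite pull_frob // rmorphM.
- by move=> t p; rewrite pull_frob // rmorphM mulrCA mulrN.
- exact: al1.
- exact: al2.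
- exact: be1.
- exact: be2.
- exact: al1.
- exact: al2.
- exact: be1.
- exact: be2.
move=> a _; rewrite pull0_frob pullx_frob.
have [I0 _ _] := is_ideal_face_ideal K Phi.
(* The inverse splitting sends (p, x q) to the diagonal of p minus x' times the diagonal of q. *)
suff [e0 e1] : twin0 (a - (twin_diag (twin0 a) -
      @var K V' None * twin_diag (twin_diff a))) = 0 /\
    twin1 (a - (twin_diag (twin0 a) - @var K V' None * twin_diag (twin_diff a))) = 0.
  by split; rewrite ?e0 ?e1.
split; rewrite !rmorphB rmorphM /= ?twin0_diag ?twin1_diag.
  by rewrite [_ (@var K V' None)]subst_var mul0r subr0 subrr.
by rewrite [_ (@var K V' None)]subst_var mul_twin_diff; ring.
Qed.

(** x x' annihilates the module, so the bottom prime contains x or x'. Modulo it every polynomial is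
    congruent to a diagonal one, so pulling back along [twin_diag] keeps inclusions strict. *)
Lemma twin_prime_chain Phi Psi e :
  has_prime_chain (twin_lift (face_ideal Psi)) (twin_lift (face_ideal Phi)) e ->
  has_prime_chain (face_ideal (K := K) Psi) (face_ideal Phi) e.
Proof.
set I := face_ideal Phi; set J := face_ideal Psi => -[P [P1 P2]].
have idI : is_ideal I := is_ideal_face_ideal K Phi.
have [J0 _ _] : is_ideal J := is_ideal_face_ideal K Psi.
have P0i i : (i <= e)%N -> sub_pred (P 0%N) (P i).
  elim: i => [|i IH] ie a; first by [].
  by move/(IH (ltnW ie)); apply: (P2 i ie).1.
have xy : P 0%N (@var K V' (Some x)) \/ P 0%N (@var K V' None).
  have [[_ _ prM] annP] := P1 0%N isT; apply: prM; apply: annP => a _.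
  have [_ _ LM] := is_ideal_twin_lift idI; rewrite mulrC; apply: LM.
  case: idI => I0 _ _; split; rewrite rmorphM /= ![_ (var K _)]subst_var /=.
    by rewrite mulr0.
  by rewrite eqxx mul0r.
have [rho rhoP] : exists rho : S' -> S, forall i a, (i <= e)%N ->
    P i a <-> P i (twin_diag (rho a)).
  have congr Q a b : is_ideal Q -> Q (a - b) -> Q a <-> Q b.
    move=> [Q0 QD QM] Qab; split=> [Qa|Qb]; last by rewrite -[a](subrK b); apply: QD.
    have -> : b = a - (a - b) by ring.
    by apply: idealB.
  have cst (rho : S' -> S) c : rho c%:MP = c%:MP ->
      c%:MP = twin_diag (rho c%:MP) by move=> ->; rewrite [RHS]substC.
  case: xy => Pxy; [exists twin1 | exists twin0] => i a ie;
    have [[idP _ _] _] := P1 i ie; have [Pi0 _ PM] := idP; apply: congr => //;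
    have {}Pxy := P0i i ie _ Pxy.
    apply: (rmorph_mpoly_congr (f := idfun) (g := twin_diag \o twin1)) => //= [c|].
      by apply: cst; apply: substC.
    case=> [v|]; rewrite [twin1 _]subst_var /=.
      case: eqP => [->|vx]; first by rewrite rmorph0 subr0.
      by rewrite [twin_diag _]subst_var /twin_diag_var; case: eqP => // _; rewrite addr0 subrr.
    rewrite [twin_diag _]subst_var /twin_diag_var eqxx opprD addrCA subrr addr0.
    exact: idealN.
  apply: (rmorph_mpoly_congr (f := idfun) (g := twin_diag \o twin0)) => //= [c|].
    by apply: cst; apply: substC.
  case=> [v|]; rewrite [twin0 _]subst_var /=; last by rewrite rmorph0 subr0.
  rewrite [twin_diag _]subst_var /twin_diag_var opprD addrA subrr add0r; apply: idealN => //.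
  by case: ifP.
exists (fun i p => P i (twin_diag p)); split=> i ie.
  have [[idP P1n prM] annP] := P1 i ie; have [Pi0 PD PM] := idP; split; last first.
    move=> p Ap; apply: annP => a [J0a J1a]; split; rewrite rmorphM /=.
      by rewrite twin0_diag; apply: Ap.
    by rewrite twin1_diag; apply: Ap.
  split; [split | |].
  - by rewrite rmorph0.
  - by move=> p q; rewrite rmorphD; apply: PD.
  - by move=> p q; rewrite rmorphM; apply: PM.
  - by rewrite rmorph1.
  - by move=> p q; rewrite rmorphM; apply: prM.
have [sub nsub] := P2 i ie; split; first by move=> p; apply: sub.
move=> sub'; apply: nsub => a /(rhoP _ _ ie)/sub' Pa; exact/(rhoP i a (ltnW ie)).
Qed.

(** The regular sequence consists of the diagonal e_k themselves; squared variables occur only in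
    the module from which regularity descends. *)
Theorem CM_twin_lift Phi Psi d :
  let I := face_ideal (K := K) Phi in let J := face_ideal Psi in
  sub_pred I J -> krull_dim J I d -> CM_module J I ->
  krull_dim (twin_lift J) (twin_lift I) d /\
  CM_module (twin_lift J) (twin_lift I).
Proof.
move=> I J IJ kd cm.
pose gs := map twin_diag (mkseq (fun i => elem_sym K V i.+1) d).
have gI : graded_ideal I := graded_face_ideal K Phi.
have gJ : graded_ideal J := graded_face_ideal K Psi.
have hgs : homog_pos_seq gs.
  move=> _ /mapP[_ /mapP[k _ ->] ->]; exists k.+1 => //.
  rewrite -[X in X.-homog]mul1n; apply: subst_homog; last exact: elem_sym_homog.
  move=> v; apply: rpredD; first exact: var_homog.
  by case: ifP => _; [exact: var_homog | exact: dhomog0].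
apply: (CM_module_criterion (fs := gs)) => //.
- exact: graded_twin_lift.
- exact: graded_twin_lift.
- by move=> a [? ?]; split; apply: IJ.
- by rewrite size_map size_mkseq.
- apply: weak_regular_seq_regular => //; try exact: graded_twin_lift.
    move=> sub; have [_ _ [[fs [_ _ rfs]] _]] := cm.
    apply: (regular_seq_nonzero gJ.1 rfs) => p Jp.
    have [] : twin_lift I (twin_diag p); last by rewrite twin0_diag.
    by apply: sub; split; rewrite ?twin0_diag ?twin1_diag.
  exact/twin_weak_regular/CM_frob_elem_sym_regular.
- by move=> e /twin_prime_chain; apply: kd.2.
Qed.

End Twin.

(** * The dimension filtration *)

(* [M i] is the intersection of the face primes of dimension greater than     *)
(* [d i.-1].                                                                  *)
Lemma dimension_filtration (K : fieldType) (V : finType) (D : {set V} -> Prop)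
    r (M : nat -> {mpoly K[#|V|]} -> Prop) d :
  M 0%N = face_ideal D -> M r = whole ->
  (forall i, (i <= r)%N -> graded_ideal (M i)) ->
  (forall i, (i < r)%N -> [/\ sub_pred (M i) (M i.+1), CM_module (M i.+1) (M i)
                            & krull_dim (M i.+1) (M i) (d i)]) ->
  (forall i, (i.+1 < r)%N -> (d i < d i.+1)%N) ->
  forall i, (i <= r)%N -> exists Phi, M i = face_ideal Phi.
Proof.
move=> M0 Mr gM MM dd i ir.
have dmono l j : (l < j)%N -> (j < r)%N -> (d l < d j)%N.
  elim: j => // j IHj; rewrite ltnS leq_eqVlt => /predU1P[->|lj] jr; first exact: dd.
  exact: ltn_trans (IHj lj (ltnW jr)) (dd _ jr).
(* [above F e] says that the face prime of [F] has dimension at least [e]. *)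
pose above F e := prime_chain_above (fun p : {mpoly K[#|V|]} => ev F p = 0) e.
pose Phi F := D F /\ forall j, (j < i)%N -> exists2 e, (d j < e)%N & above F e.
exists Phi; apply: pred_ext => u; split.
  (* Descent from M i to M 0: a face prime of dimension above d_j does not contain the annihilator
     of the j-th quotient, so some [s] outside it moves [u] one term down. *)
  move=> + F [DF Fi]; have: (i <= i)%N by [].
  elim: {1 3}i u => [|j IH] u ji.
    by rewrite M0; apply.
  have jr := leq_trans ji ir; have [_ _ [_ dmax]] := MM j jr => Mu.
  have [s [As sF]] : exists s, ann (M j.+1) (M j) s /\ ev F s != 0.
    apply: NNPP => nex; have [e de ae] := Fi j ji.
    have : (e <= d j)%N; last by lia.
    apply: dmax; apply: prime_chain_above_sub ae => s As.
    by apply/eqP; apply: NNPP => /negP sF; apply: nex; exists s.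
  have /eqP := IH (s * u) (ltnW ji) (As u Mu).
  by rewrite rmorphM mulf_eq0 (negbTE sF) => /eqP.
(* Descent from M r: if [u] dropped out at a step j >= i, unmixedness would give a prime over (M j :
   u) of dimension at least d_j. It contains the prime of a face in [D] but not in [Phi], whose
   dimension nevertheless exceeds d_l for all l < i. *)
move=> Iu; suff S k : (k <= r - i)%N -> M (r - k)%N u.
  by have := S (r - i)%N (leqnn _); rewrite subKn.
elim: k => [|k IH] kr; first by rewrite subn0 Mr.
have [j ej] : exists j, (r - k.+1 = j)%N by exists (r - k.+1)%N.
rewrite ej; have {}ej : (r - k = j.+1)%N by lia.
have jr : (j < r)%N by lia.
have ij : (i <= j)%N by lia.
apply: NNPP => nMu; have {IH} := IH (ltnW kr); rewrite ej => Mu.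
have [MjMj [d' [dch' dmax'] [[fs [szfs hfs rfs]] _]] [dch dmax]] := MM j jr.
have szd : size fs = d j.
  by apply/eqP; rewrite szfs eqn_leq dmax // dmax'.
have := regular_seq_prime_chain (gM j (ltnW jr)) (gM j.+1 jr) MjMj hfs
  (regular_seq_weak rfs) Mu nMu.
rewrite szd => -[P [P1 P2]]; have [prP cP] := P1 0%N isT.
have [_ P1' prM] := prP.
have subM l l' : (l <= l')%N -> (l' <= r)%N -> sub_pred (M l) (M l').
  move=> ll'; rewrite -(subnK ll'); elim: (l' - l)%N => [|q IHq] qr a; first by [].
  by move/(IHq (ltnW qr)); have [+ _ _] := MM _ qr; apply.
have [F [DF PF nPhi]] : exists F, [/\ D F,
    sub_pred (fun p : {mpoly K[#|V|]} => ev F p = 0) (P 0%N) & ~ Phi F].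
  apply: NNPP => nex.
  (* Without such a face, a product of elements of the primes of all faces in [D] outside [Phi]
     would avoid [P 0] and carry [u] into M 0. *)
  have [s ns sE] : exists2 s, ~ P 0%N s & forall F, D F -> ~ Phi F -> ev F s = 0.
    suff [s ns sE] : exists2 s, ~ P 0%N s &
        forall F, F \in enum {set V} -> D F -> ~ Phi F -> ev F s = 0.
      by exists s => // F; apply: sE; rewrite mem_enum.
    elim: (enum _) => [|F l [s ns sE]]; first by exists 1.
    have [[DF nF]|nDF] := classic (D F /\ ~ Phi F).
      have [t [tF nt]] : exists t, ev F t = 0 /\ ~ P 0%N t.
        apply: NNPP => nt; apply: nex; exists F; split=> // t tF.
        by apply: NNPP => nPt; apply: nt; exists t.
      exists (s * t); first by case/prM.
      move=> F'; rewrite inE => /orP[/eqP ->|F'l] DF' nF'; rewrite rmorphM /=.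
        by rewrite tF mulr0.
      by rewrite sE // mul0r.
    exists s => // F'; rewrite inE => /orP[/eqP -> ? ?|]; last exact: sE.
    by case: nDF.
  apply: ns; apply: cP; apply: (subM 0%N) => //; first exact: ltnW.
  rewrite M0 => F DF; rewrite rmorphM /=.
  have [/Iu ->|nF] := classic (Phi F); first by rewrite mulr0.
  by rewrite sE // mul0r.
apply: nPhi; split=> // l li; exists (d j); last first.
  exists P; split=> // m md; split; first exact: (P1 m md).1.
  move=> p /PF; elim: m md => [//|m IHm] md /(IHm (ltnW md)).
  exact: (P2 m md).1.
exact: dmono (leq_trans li ij) jr.
Qed.

(** * Twin vertices in graphs *)

Lemma indepP (W : finType) (H : sgraph W) (A : {set W}) :
  reflect (forall u v, u \in A -> v \in A -> ~~ adj H u v) (A \in indep_complex H).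
Proof.
rewrite inE; apply: (iffP forall_inP) => [ind u v uA vA|ind e].
  apply/negP => uv; have: [set u; v] \in edges H.
    by rewrite inE; apply/existsP; exists u; apply/existsP; exists v; rewrite uv /=.
  by move/ind; rewrite subUset !sub1set uA vA.
rewrite inE => /existsP[u /existsP[v /andP[uv /eqP ->]]].
rewrite subUset !sub1set; apply/negP => /andP[uA vA].
by have := ind u v uA vA; rewrite uv.
Qed.

Lemma indep_sub (W : finType) (H : sgraph W) (A B : {set W}) :
  A \subset B -> B \in indep_complex H -> A \in indep_complex H.
Proof.
move=> /subsetP AB /indepP indB; apply/indepP => u v uA vA.
by apply: indB; apply: AB.
Qed.

Lemma facetP (W : finType) (C : {set {set W}}) (A : {set W}) :
  reflect (A \in C /\ forall B, B \in C -> A \subset B -> B = A) (A \in facets C).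
Proof. by rewrite inE; apply: maxsetP. Qed.

(** Each facet of the intersection complex is the intersection of [A] with a member of [s]. *)
Lemma shelling_stepP (W : finType) (s : seq {set W}) (A : {set W}) :
  (forall E, E \in facets (shelling_meet s A) -> #|E|.+1 = #|A|) <->
  (forall B, B \in s -> exists2 C, C \in s & A :&: B \subset C /\ #|A :&: C|.+1 = #|A|).
Proof.
have meetP (E : {set W}) : reflect (E \subset A /\ exists2 B, B \in s & E \subset B)
    (E \in shelling_meet s A).
  by rewrite inE; apply: (iffP andP) => -[EA /hasP]; split=> //; apply/hasP.
split=> [st B Bs|st E /facetP[/meetP[EA [B Bs EB]] Emax]].
  have [E Emax sE] : {E | maxset (fun E => E \in shelling_meet s A) E & A :&: B \subset E}.
    by apply: maxset_exists; apply/meetP; split; [exact: subsetIl |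
      exists B; rewrite // subsetIr].
  have Ef : E \in facets (shelling_meet s A) by rewrite inE.
  have /facetP[/meetP[EA [C Cs EC]] Em] := Ef; exists C => //; split.
    exact: subset_trans EC.
  rewrite (Em (A :&: C)) ?st // ?subsetI ?EA //.
  by apply/meetP; split; [exact: subsetIl | exists C; rewrite // subsetIr].
have [C Cs [ABC <-]] := st B Bs; congr _.+1.
suff <- : A :&: C = E by [].
apply: Emax.
  by apply/meetP; split; [exact: subsetIl | exists C; rewrite // subsetIr].
by rewrite subsetI EA (subset_trans _ ABC) // subsetI EA.
Qed.

(** Matches a twin's predecessors in the new shelling with facets that precede its original in the
    old one. *)
Lemma take_filter (T : eqType) (t0 : T) (p : pred T) s i :
  (i < size (filter p s))%N -> exists k, [/\ (k < size s)%N,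
    nth t0 s k = nth t0 (filter p s) i & take i (filter p s) = filter p (take k s)].
Proof.
elim: s i => //= y s IH i; case: ifP => py; last first.
  by move=> /IH[k [ks ek et]]; exists k.+1; split=> //=; rewrite py.
case: i => [|i] /=; first by exists 0%N.
by move=> /IH[k [ks ek et]]; exists k.+1; split=> //=; rewrite py et.
Qed.

Section Graph.
Variables (V : finType) (G : sgraph V) (x : V).
Local Notation V' := (Datatypes_option__canonical__fintype_Finite V).
Local Notation D := (indep_complex G).
Local Notation D' := (indep_complex (add_twin G x)).
Implicit Types (E F : {set V}) (A : {set V'}).

Definition old_face F : {set V'} := [set w : V' | if w is Some v then v \in F else false].

(** Replaces x by x' if x lies in [F]; otherwise agrees with [old_face F]. *)
Definition twin_face F : {set V'} :=
  [set w : V' | if w is Some v then (v != x) && (v \in F) else x \in F].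

Lemma old_face_indep F : (old_face F \in D') = (F \in D).
Proof.
apply/indepP/indepP => ind.
  by move=> u v uF vF; apply: (ind (Some u) (Some v)); rewrite inE.
by case=> [u|] [v|]; rewrite !inE //; apply: ind.
Qed.

Lemma twin_face_indep F : F \in D -> twin_face F \in D'.
Proof.
move=> /indepP ind; apply/indepP => -[u|] [v|]; rewrite !inE //=.
- by move=> /andP[_ uF] /andP[_ vF]; apply: ind.
- by move=> /andP[ux uF] xF; rewrite !inE (negbTE ux) /=; apply: ind.
- by move=> xF /andP[vx vF]; rewrite !inE (negbTE vx) /=; apply: ind.
Qed.

(** An independent set with x' misses N[x]; exchanging x' for x leaves it independent. *)
Lemma twin_complexP A : A \in D' ->
  (exists2 F, F \in D & A = old_face F) \/
  (exists F, [/\ F \in D, x \in F & A = twin_face F]).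
Proof.
move=> /indepP ind; case: (boolP (None \in A)) => [NA|NA]; [right | left].
  have Ax : Some x \notin A.
    by apply/negP => xA; have := ind _ _ NA xA; rewrite /= !inE eqxx.
  exists (x |: [set v | Some v \in A]); split; last 1 first.
  - apply/setP => -[v|]; rewrite !inE ?eqxx //=.
    by case: eqP => // ->; apply/negbTE.
  - have xv v : Some v \in A -> ~~ adj G x v.
      move=> vA; have := ind _ _ NA vA.
      by rewrite /= !inE; case: eqP => [-> _|//]; rewrite adj_irrefl.
    apply/indepP => u v; rewrite !inE => /predU1P[->|uA] /predU1P[->|vA].
    + by rewrite adj_irrefl.
    + exact: xv.
    + by rewrite adj_sym; apply: xv.
    + exact: (ind _ _ uA vA).
  - by rewrite !inE eqxx.
have eA : A = old_face [set v | Some v \in A].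
  by apply/setP => -[v|]; rewrite !inE //; apply/negbTE.
by exists [set v | Some v \in A]; rewrite // -old_face_indep -eA; apply/indepP.
Qed.

(** Evaluation at old faces factors through [twin0], at twin faces through [twin1]. *)
Lemma SR_ideal_twin (K : fieldType) :
  @SR_ideal K V' D' = twin_lift x (@SR_ideal K V D).
Proof.
rewrite !SR_idealE; try by move=> F F'; apply: indep_sub.
apply: pred_ext => a; split=> [Ia|[I0 I1] A /twin_complexP].
  split=> F FD.
    have <- : twin0 (ev (old_face F) a) = ev F (twin0 a).
      rewrite /ev /twin0 !subst_comp; apply: eq_subst => -[v|];
        rewrite !inE /= ?rmorph0 ?subst_var //.
      by case: ifP; rewrite ?subst_var ?rmorph0.
    by rewrite Ia ?old_face_indep // rmorph0.
  have <- : twin1 x (ev (twin_face F) a) = ev F (twin1 x a).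
    rewrite /ev /twin1 !subst_comp; apply: eq_subst => -[v|] /=; rewrite !inE /=.
      case: eqP => [->|/eqP/negbTE vx] /=; rewrite ?rmorph0 // subst_var.
      by case: ifP; rewrite ?subst_var ?rmorph0 //= vx.
    by rewrite subst_var; case: ifP; rewrite ?subst_var ?rmorph0.
  by rewrite Ia ?twin_face_indep // rmorph0.
case=> [[F FD ->]|[F [FD xF ->]]].
  have -> : ev (old_face F) a = subst (fun v => @var K V' (Some v)) (ev F (twin0 a)).
    rewrite /ev /twin0 !subst_comp; apply: eq_subst => -[v|]; rewrite !inE /=.
      by rewrite subst_var; case: ifP; rewrite ?subst_var ?rmorph0.
    by rewrite !rmorph0.
  by rewrite I0 // rmorph0.
have -> : ev (twin_face F) a =
    subst (fun v => @var K V' (if v == x then None else Some v)) (ev F (twin1 x a)).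
  rewrite /ev /twin1 !subst_comp; apply: eq_subst => -[v|]; rewrite !inE /=.
    case: eqP => [->|/eqP/negbTE vx] /=; rewrite ?rmorph0 // subst_var.
    by case: ifP; rewrite ?subst_var ?rmorph0 ?vx.
  by rewrite subst_var xF subst_var eqxx.
by rewrite I1 // rmorph0.
Qed.

(** An old facet [F] inside the twin of some F' through x would equal F' by maximality, but twins
    miss x. *)
Lemma facets_twin A : A \in facets D' <->
  (exists2 F, F \in facets D & A = old_face F) \/
  (exists F, [/\ F \in facets D, x \in F & A = twin_face F]).
Proof.
have old_sub F F' : (old_face F \subset old_face F') = (F \subset F').
  apply/subsetP/subsetP => FF' v; first by have := FF' (Some v); rewrite !inE.
  by case: v => [v|]; rewrite !inE //; apply: FF'.
have twin_sub F F' : x \in F' -> (twin_face F \subset twin_face F') = (F \subset F').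
  move=> xF'; apply/subsetP/subsetP => FF' v.
    by have := FF' (Some v); rewrite !inE; case: eqP => [->|_].
  by case: v => [v|]; rewrite !inE //; case: eqP => //= _; apply: FF'.
split.
  case/facetP => AD Amax; case: (twin_complexP AD) => [[F FD eA]|[F [FD xF eA]]].
    left; exists F => //; apply/facetP; split=> // F' F'D FF'.
    apply/eqP; rewrite eqEsubset FF' andbT -old_sub -eA.
    by rewrite (Amax (old_face F')) ?old_face_indep // eA old_sub.
  right; exists F; split=> //; apply/facetP; split=> // F' F'D FF'.
  have xF' := subsetP FF' x xF; apply/eqP; rewrite eqEsubset FF' andbT -twin_sub //.
  by rewrite -eA (Amax (twin_face F')) ?twin_face_indep // eA twin_sub.
case=> [[F /facetP[FD Fmax] ->]|[F [/facetP[FD Fmax] xF ->]]]; apply/facetP.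
  split; first by rewrite old_face_indep.
  move=> B /twin_complexP[[F' F'D ->]|[F' [F'D xF' ->]]].
    by rewrite old_sub => /(Fmax _ F'D) ->.
  move=> /subsetP sub; have eF : F' = F.
    apply: Fmax => //; apply/subsetP => v vF.
    by have := sub (Some v); rewrite !inE => /(_ vF)/andP[].
  by have := sub (Some x); rewrite !inE eqxx -eF => /(_ xF').
split; first exact: twin_face_indep.
move=> B /twin_complexP[[F' F'D ->]|[F' [F'D xF' ->]]].
  by move/subsetP/(_ None); rewrite !inE => /(_ xF).
by rewrite twin_sub // => /(Fmax _ F'D) ->.
Qed.

Lemma shellable_add_twin : shellable_graph G -> shellable_graph (add_twin G x).
Proof.
move=> [s [us sf sh]].
have card_old F : #|old_face F| = #|F|.
  have Some_inj : injective (@Some V) by move=> ? ? [].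
  rewrite -(card_imset (mem F) Some_inj); apply: eq_card => -[v|]; rewrite !inE.
    by rewrite mem_imset.
  by apply: esym; apply/negbTE; apply/imsetP => -[].
have old_inj : injective old_face.
  by move=> F F' e; apply/setP => v; have /setP/(_ (Some v)) := e; rewrite !inE.
have twinE F : x \in F -> twin_face F = None |: old_face (F :\ x).
  by move=> xF; apply/setP => -[v|]; rewrite !inE.
have card_twin F : x \in F -> #|twin_face F| = #|F|.
  by move=> xF; rewrite twinE // cardsU1 !inE /= card_old [RHS](cardsD1 x) xF.
have oldI F F' : old_face F :&: old_face F' = old_face (F :&: F').
  by apply/setP => -[v|]; rewrite !inE.
have twinI F F' : twin_face F :&: twin_face F' = twin_face (F :&: F').
  by apply/setP => -[v|]; rewrite !inE //; case: eqP.
have twin_oldI F F' : twin_face F :&: old_face F' = old_face ((F :\ x) :&: F').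
  by apply/setP => -[v|]; rewrite !inE ?andbF.
have step k : (k < size s)%N -> forall F', F' \in take k s -> exists2 F'',
    F'' \in take k s & nth set0 s k :&: F' \subset F'' /\
                       #|nth set0 s k :&: F''|.+1 = #|nth set0 s k|.
  case: k => [|k] ks; first by rewrite take0.
  by apply/shelling_stepP => E; apply: sh.
pose t := [seq F : {set V} <- s | x \in F].
have szs : size (map old_face s) = size s by rewrite size_map.
exists (map old_face s ++ map twin_face t); split.
- rewrite cat_uniq map_inj_uniq // us /=; apply/andP; split.
    apply/hasPn => _ /mapP[F + ->]; rewrite mem_filter => /andP[xF _].
    by apply/mapP => -[F' _] /setP/(_ None); rewrite !inE xF.
  rewrite map_inj_in_uniq ?filter_uniq // => F F'; rewrite !mem_filter.
  move=> /andP[xF _] /andP[xF' _] /setP e; apply/setP => v.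
  by have := e (Some v); rewrite !inE; case: eqP => [->|]; rewrite ?xF ?xF'.
- move=> A; rewrite mem_cat; apply/idP/idP => [|/facets_twin].
    case/orP=> /mapP[F Fs ->]; apply/facets_twin; [left; exists F | right; exists F].
      by rewrite -sf.
      by [].
    by move: Fs; rewrite mem_filter sf => /andP[].
  case=> [[F Ff ->]|[F [Ff xF ->]]]; apply/orP; [left | right]; apply: map_f.
    by rewrite sf.
  by rewrite mem_filter xF sf.
move=> j /andP[_ jlt]; apply/shelling_stepP; rewrite take_cat nth_cat szs.
move: jlt; rewrite size_cat szs => jlt.
have [js|sj] := boolP (j < size s)%N; rewrite ?js ?(negbTE sj).
  rewrite (nth_map set0) // -map_take => _ /mapP[F1 F1s ->].
  have [F2 F2s [sub card]] := step j js F1 F1s.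
  exists (old_face F2); first exact: map_f.
  rewrite !oldI !card_old card; split=> //; apply/subsetP => -[v|]; rewrite !inE //.
  by move=> vF; apply: (subsetP sub); rewrite inE.
set i := (j - size s)%N.
have it : (i < size t)%N by move: jlt; rewrite size_map /i; move: sj; rewrite -leqNgt; lia.
have [k [ks ek et]] := take_filter set0 it; rewrite -/t in et.
rewrite (nth_map set0) // -ek -map_take et.
set F := nth set0 s k; have Fs : F \in s by apply: mem_nth.
have xF : x \in F.
  by have: F \in t by [rewrite /F ek mem_nth]; rewrite mem_filter => /andP[].
move=> B; rewrite mem_cat => /orP[] /mapP[F1 F1s ->].
  (* Against an old facet the original of [F] serves: it meets the twin in F minus x. *)
  exists (old_face F); first by rewrite mem_cat map_f.
  rewrite !twin_oldI card_old card_twin // (setIidPl (subD1set _ _)); split.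
    apply/subsetP => -[v|]; rewrite !inE //; by case/andP=> /andP[].
  by rewrite [RHS](cardsD1 x) xF.
move: F1s; rewrite mem_filter => /andP[xF1 F1s].
(* [F] and [F1] contain x, hence so does the [F2] from the shelling of G, and its twin comes
   earlier. *)
have [F2 F2s [sub card]] := step k ks F1 F1s.
have xF2 : x \in F2 by apply: (subsetP sub); rewrite inE xF.
exists (twin_face F2).
  by rewrite mem_cat (map_f twin_face) ?orbT // mem_filter xF2.
rewrite !twinI !card_twin ?inE ?xF ?xF2 //; split=> //.
apply/subsetP => -[v|]; rewrite !inE ?xF2 // => /andP[-> /andP[vF vF1]].
by apply: (subsetP sub); rewrite inE vF.
Qed.

End Graph.

Theorem corollary4p3 (K : fieldType) (V : finType) (G : sgraph V) (x : V) :
  (CM_graph K G -> CM_graph K (add_twin G x)) /\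
  (seqCM_graph K G -> seqCM_graph K (add_twin G x)) /\
  (shellable_graph G -> shellable_graph (add_twin G x)).
Proof.
have SRE : @SR_ideal K V (indep_complex G) = face_ideal (fun F => F \in indep_complex G).
  by apply: SR_idealE => F F'; apply: indep_sub.
(* As an intersection over no faces, the whole ring fits [CM_twin_lift]. *)
have face_whole : whole = face_ideal (K := K) (fun _ : {set V} => False).
  by apply: pred_ext => p; split=> // _ F [].
split; last split; last exact: shellable_add_twin.
  rewrite /CM_graph /CM_complex SR_ideal_twin => cm.
  have [d kd _] := cm; move: cm kd; rewrite SRE face_whole => cm kd.
  have [] := CM_twin_lift x _ kd cm; first by rewrite -face_whole.
  move=> _; rewrite -face_whole.
  suff -> : twin_lift x (@whole {mpoly K[#|V|]}) = whole by [].
  by apply: pred_ext.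
rewrite /seqCM_graph /seqCM_complex SR_ideal_twin => -[r [M [d [[M0 Mr] gM MM dd]]]].
have sq := dimension_filtration (etrans (pred_ext M0) SRE) (pred_ext Mr) gM MM dd.
exists r, (fun i => twin_lift x (M i)), d; split.
- by rewrite (pred_ext M0) (pred_ext Mr); split=> // a; split.
- by move=> i ir; apply: graded_twin_lift; apply: gM.
- move=> i ir; have [sub cm kd] := MM i ir.
  have [Phi ePhi] := sq i (ltnW ir); have [Psi ePsi] := sq i.+1 ir.
  move: sub cm kd; rewrite ePhi ePsi => sub cm kd.
  have [kd' cm'] := CM_twin_lift x sub kd cm; split=> //.
  by move=> a [? ?]; split; apply: sub.
- exact: dd.
Qed.
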